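(* Let $N\ge3$ and $2^*=2N/(N-2)$. For any smooth bounded domain $\Omega\subset\mathbb R^N$, it holds $$\lim_{p\to 2\cdot 2^*}\mathfrak m_p=m_*,$$ where the limit is taken over $p\in(4,2\cdot 2^* )$.
   Context: Let $f:\mathbb R\to\mathbb R$ be the odd function with $f(0)=0$ and $f'(t)=(1+2f(t)^2)^{-1/2}$ for $t\ge0$. On $H_0^1(\Omega)$, with norm $\|v\|^2=\int_\Omega|\nabla v|^2$, for $p\in(4,2\cdot2^*]$ let $$I_p(v)=\frac12\|v\|^2-\frac1p\int_\Omega|f(v)|^p,\qquad \mathcal N_p=\{v\in H_0^1(\Omega)\setminus\{0\}: I_p'(v)[v]=0\},$$ where $I_p'(v)[w]=\int_\Omega\nabla v\nabla w-\int_\Omega|f(v)|^{p-2}f(v)f'(v)w$. For $p\in(4,2\cdot 2^* )$ put $\mathfrak m_p=\min_{v\in\mathcal N_p}I_p(v)$ (the minimum is achieved). Put $I_*=I_{2\cdot2^*}$, $\mathcal N_*=\mathcal N_{2\cdot 2^*}$ and $m_*=\inf_{v\in\mathcal N_*}I_*(v)$. *)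

(* Defs.v *)
From HB Require Import structures.
From mathcomp Require Import all_boot all_order all_algebra.
From mathcomp Require Import all_classical all_reals all_analysis.

Set Implicit Arguments.
Unset Strict Implicit.
Unset Printing Implicit Defensive.

Import Order.TTheory GRing.Theory Num.Def Num.Theory.
Import numFieldNormedType.Exports.

Local Open Scope classical_set_scope.
Local Open Scope ring_scope.

(* 'rV[R]_n with the product sigma-algebra of the Borel sets of R; Lebesgue
   measure on it is obtained by induction on n as the image of the product
   measure under the linear bijection R * R^n -> R^(n+1). *)
Definition measure_rV_display : measure_display.
Proof. exact. Qed.

Section measurable_rV.
Context {R : realType} (n : nat).

Let coords : 'I_n -> 'rV[R]_n -> R := fun i x => x ord0 i.

Let rV_set0 : g_sigma_preimage coords set0.
Proof. exact: sigma_algebra0. Qed.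

Let rV_setC A : g_sigma_preimage coords A -> g_sigma_preimage coords (~` A).
Proof. exact: sigma_algebraC. Qed.

Let rV_bigcup (F : _^nat) : (forall i, g_sigma_preimage coords (F i)) ->
  g_sigma_preimage coords (\bigcup_i (F i)).
Proof. exact: sigma_algebra_bigcup. Qed.

HB.instance Definition _ := @isMeasurable.Build measure_rV_display
  'rV[R]_n (g_sigma_preimage coords) rV_set0 rV_setC rV_bigcup.

End measurable_rV.

Definition cons_rV {R : realType} {n : nat}
    (p : measurableTypeR R * 'rV[R]_n) : 'rV[R]_n.+1 :=
  row_mx (const_mx p.1) p.2 : 'rV[R]_(1 + n).

Section measurable_cons_rV.
Context {R : realType}.

Lemma measurable_coord_rV n (i : 'I_n) :
  measurable_fun setT (fun x : 'rV[R]_n => x ord0 i).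
Proof.
move=> _ Y mY; rewrite setTI; apply: sub_sigma_algebra => /=.
rewrite -bigcup_seq/=; exists i => /=; first by rewrite mem_index_enum.
by exists Y => //; rewrite setTI.
Qed.

Lemma measurable_fun_rVP d (T : measurableType d) n (f : T -> 'rV[R]_n) :
  (forall i, measurable_fun setT (fun x => f x ord0 i)) ->
  measurable_fun setT f.
Proof.
move=> mf _ A mA; rewrite setTI.
pose G := [set B : set 'rV[R]_n | measurable (f @^-1` B)].
suff : measurable `<=` G by apply.
apply: smallest_sub.
  split=> [|B GB|F GF]; rewrite /G /=.
  - by rewrite preimage_set0.
  - by rewrite setTD -preimage_setC; exact: measurableC.
  - by rewrite preimage_bigcup; apply: bigcup_measurable => k _; exact: GF.
rewrite -bigcup_seq => B [i _ [C mC <-]]; rewrite /G /= setTI.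
by have := mf i measurableT C mC; rewrite setTI.
Qed.

Lemma cons_rV0 n (p : measurableTypeR R * 'rV[R]_n) : cons_rV p ord0 ord0 = p.1.
Proof.
transitivity ((const_mx p.1 : 'rV[R]_1) ord0 ord0); last by rewrite mxE.
rewrite -(row_mxEl (const_mx p.1 : 'rV[R]_1) p.2 ord0 ord0).
by congr (fun_of_matrix _ _ _); exact: val_inj.
Qed.

Lemma cons_rVS n (p : measurableTypeR R * 'rV[R]_n) (j : 'I_n) :
  cons_rV p ord0 (lift ord0 j) = p.2 ord0 j.
Proof.
rewrite -(row_mxEr (const_mx p.1 : 'rV[R]_1) p.2 ord0 j).
by congr (fun_of_matrix _ _ _); exact: val_inj.
Qed.

Lemma measurable_cons_rV n :
  measurable_fun setT (@cons_rV R n).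
Proof.
apply: measurable_fun_rVP => i.
have [j ->|->] := unliftP ord0 i.
  under eq_fun do rewrite cons_rVS.
  exact: (measurableT_comp (measurable_coord_rV j) measurable_snd).
under eq_fun do rewrite cons_rV0.
exact: measurable_fst.
Qed.

Definition uncons_rV n (x : 'rV[R]_n.+1) : measurableTypeR R * 'rV[R]_n :=
  (x ord0 ord0, \row_j x ord0 (lift ord0 j)).

Lemma cons_rVK n : cancel (@cons_rV R n) (@uncons_rV n).
Proof.
move=> p; rewrite /uncons_rV cons_rV0 [RHS]surjective_pairing; congr pair.
by apply/rowP => j; rewrite mxE cons_rVS.
Qed.

Lemma measurable_uncons_rV n : measurable_fun setT (@uncons_rV n).
Proof.
apply/measurable_fun_pairP; split; first exact: measurable_coord_rV.
apply: measurable_fun_rVP => i.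
rewrite (_ : (fun _ => _) = (fun x : 'rV[R]_n.+1 => x ord0 (lift ord0 i))).
  exact: measurable_coord_rV.
by apply/funext => x; rewrite /= mxE.
Qed.

End measurable_cons_rV.

Section lebesgue_rV_step.
Context {R : realType} (n : nat).
Variable mu : {sigma_finite_measure set 'rV[R]_n -> \bar R}.

Definition lebesgue_rV_step : set 'rV[R]_n.+1 -> \bar R :=
  pushforward (@lebesgue_measure R \x mu)%E (@cons_rV R n).

HB.instance Definition _ :=
  Measure.copy lebesgue_rV_step
    (measure_function_pushforward__canonical__measure_function_Measure
       (@lebesgue_measure R \x mu)%E (@measurable_cons_rV R n)).

Let lebesgue_rV_step_sigma_finite : sigma_finite setT lebesgue_rV_step.
Proof.
have /sigma_finiteP[F [TF ndF Foo]] := sigma_finiteT (@lebesgue_measure R).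
have /sigma_finiteP[G [TG ndG Goo]] := sigma_finiteT mu.
exists (fun k => @uncons_rV R n @^-1` (F k `*` G k)).
  apply/esym; rewrite -subTset => x _.
  have [i _ Fi] : (\bigcup_k F k) (uncons_rV x).1 by rewrite -TF.
  have [j _ Gj] : (\bigcup_k G k) (uncons_rV x).2 by rewrite -TG.
  exists (maxn i j) => //; split.
    by move: Fi; exact/subsetPset/ndF/leq_maxl.
  by move: Gj; exact/subsetPset/ndG/leq_maxr.
move=> k; have [mF Fk] := Foo k; have [mG Gk] := Goo k; split.
  rewrite -[X in measurable X]setTI.
  by apply: measurable_uncons_rV => //; exact: measurableX.
rewrite /lebesgue_rV_step /pushforward -comp_preimage.
rewrite (_ : _ \o _ = id) ?preimage_id; last by apply/funext; exact: (@cons_rVK R n).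
by rewrite product_measure1E// lte_mul_pinfty// ge0_fin_numE.
Qed.

HB.instance Definition _ :=
  Measure_isSigmaFinite.Build _ _ _ lebesgue_rV_step
    lebesgue_rV_step_sigma_finite.

End lebesgue_rV_step.

Fixpoint lebesgue_rV (R : realType) (n : nat) :
    {sigma_finite_measure set 'rV[R]_n -> \bar R} :=
  match n with
  | 0 => dirac (0 : 'rV[R]_0)
  | m.+1 => lebesgue_rV_step (lebesgue_rV R m)
  end.

Section smoothness.
Context {R : realType} {n : nat}.
Implicit Types (u : 'rV[R]_n -> R) (Omega : set 'rV[R]_n).

Definition partial (i : 'I_n) u : 'rV[R]_n -> R :=
  fun x => 'D_(delta_mx ord0 i) u x.

Fixpoint Ck (k : nat) u : Prop :=
  if k is j.+1 then
    continuous u /\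
    forall i : 'I_n,
      (forall x, derivable u x (delta_mx ord0 i)) /\ Ck j (partial i u)
  else continuous u.

Definition smooth u := forall k, Ck k u.

Definition test_function Omega u :=
  smooth u /\
  exists K : set 'rV[R]_n,
    [/\ compact K, K `<=` Omega & forall x, ~ K x -> u x = 0].

End smoothness.

(* For open Omega: near each boundary point, after relabelling and reorienting
   the axes, Omega is the strict epigraph of a smooth function of n - 1
   variables. *)
Definition smooth_boundary {R : realType} {n : nat} (Omega : set 'rV[R]_n) :=
  forall x0, closure Omega x0 -> ~ Omega x0 ->
  exists (r : R) (i : 'I_n) (s : bool) (gamma : 'rV[R]_n.-1 -> R),
    [/\ 0 < r, smooth gamma &
        Omega `&` ball x0 r =
        [set x | gamma (col' i x) < (-1) ^+ s * x ord0 i] `&` ball x0 r].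

Definition smooth_bounded_domain {R : realType} {n : nat}
    (Omega : set 'rV[R]_n) :=
  [/\ Omega !=set0, open Omega, connected Omega, bounded_set Omega &
      smooth_boundary Omega].

(* Elements of the Sobolev spaces are represented by functions on the whole of
   R^n of which only the almost everywhere class of the restriction to Omega
   matters. *)
Section sobolev.
Context {R : realType} {n : nat}.
Variable Omega : set 'rV[R]_n.
Implicit Types (u v : 'rV[R]_n -> R) (g : 'I_n -> 'rV[R]_n -> R).

Local Notation leb := (lebesgue_rV R n).

Definition L2 u :=
  measurable_fun Omega u /\ leb.-integrable Omega (fun x => (u x ^+ 2)%:E).

Definition is_weak_grad u g :=
  forall i, L2 (g i) /\
    forall phi, test_function Omega phi ->
      \int[leb]_(x in Omega) (u x * partial i phi x) =
      - \int[leb]_(x in Omega) (g i x * phi x).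

Definition H1 := [set u | L2 u /\ exists g, is_weak_grad u g].

(* The weak gradient is determined up to a null set; this picks a
   representative (and 0 if there is none). *)
Definition weak_grad u : 'I_n -> 'rV[R]_n -> R :=
  xget (fun _ _ => 0) [set g | is_weak_grad u g].

Definition grad_dot u v : R :=
  \int[leb]_(x in Omega) (\sum_(i < n) weak_grad u i x * weak_grad v i x).

Definition H1_norm u : R :=
  sqrtr (\int[leb]_(x in Omega) (u x ^+ 2) + grad_dot u u).

Definition H10 :=
  [set u | H1 u /\ forall e : R, 0 < e ->
     exists2 phi, test_function Omega phi & H1_norm (u \- phi) < e].

Definition H10_norm u : R := sqrtr (grad_dot u u).

End sobolev.

Definition dual_change {R : realType} (f : R -> R) :=
  [/\ f 0 = 0, forall t : R, f (- t) = - f t &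
      forall t : R, 0 <= t ->
        is_derive t (1 : R) f ((1 + 2 * f t ^+ 2) `^ (- 2^-1))].

Definition critical_exponent (R : realType) (n : nat) : R :=
  2 * n%:R / (n%:R - 2).

Section nehari.
Context {R : realType} {n : nat}.
Variables (Omega : set 'rV[R]_n) (f : R -> R).
Implicit Types (p : R) (v w : 'rV[R]_n -> R).

Local Notation leb := (lebesgue_rV R n).

Definition energy p v : R :=
  2^-1 * H10_norm Omega v ^+ 2 -
  p^-1 * \int[leb]_(x in Omega) (`|f (v x)| `^ p).

(* The derivative of energy p at v in the direction w. *)
Definition denergy p v w : R :=
  grad_dot Omega v w -
  \int[leb]_(x in Omega)
    (`|f (v x)| `^ (p - 2) * f (v x) * derive1 f (v x) * w x).

Definition nehari p :=
  [set v | [/\ H10 Omega v, ~ {ae leb, forall x, Omega x -> v x = 0} &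
               denergy p v v = 0]].

(* For 4 < p <= 2 * critical_exponent, the energy is nonnegative on the
   nonempty set nehari p, so this is a genuine infimum; it is a minimum
   whenever it is attained. *)
Definition nehari_level p : R := inf (energy p @` nehari p).

End nehari.

(* Main.v *)
Require Import Defs.
From HB Require Import structures.
From mathcomp Require Import all_boot all_order all_algebra.
From mathcomp Require Import all_classical all_reals all_analysis.
From mathcomp Require Import measurable_realfun.
From mathcomp Require Import ring lra.

Set Implicit Arguments.
Unset Strict Implicit.
Unset Printing Implicit Defensive.

Import Order.TTheory GRing.Theory Num.Theory.
Import numFieldNormedType.Exports.
Local Open Scope classical_set_scope.
Local Open Scope ring_scope.

(** The theorem follows from a comparison of the energies I_p and I_q, with
    q = 2 2^*, along rays {t v : t > 0}.

    Rays. Along a ray, I_p(t v) = (t^2 / 2) ||v||^2 - int F(t v) with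
    F = |f|^p / p.  For p > 4 the function t |-> F(sqrt t s) is convex, and its
    tangent at t = 1 yields F(t s) >= F(s) + ((t^2 - 1) / 2) s F'(s)
    ([dual_pow_convex]).  Integrated over Omega, this says that a point of N_p
    maximizes I_p on its ray ([nehari_ray]).  Conversely int F(t v) grows faster
    than t^2 ([superquadratic]), so every nonzero test function has a multiple in
    N_p ([nehari_scaling]).

    Test functions. For test functions every integral is finite, whatever the
    exponent.  By [test_approx], each v in N_p has, for each e > 0, a test
    function phi with I_p(t phi) <= I_p(v) + e for all t > 0: if phi_k -> v in
    H^1 and almost everywhere, then by Fatou's lemma
    limsup I_p(t phi_k) <= I_p(t v) <= I_p(v) for each t, and
    [eventually_le_of_pointwise] makes this uniform in t.  Only upper bounds of
    I_p pass to the limit, and they are the ones that the levels require.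

    Two exponents, p < q. The function s |-> s^p / p - s^q / q is largest at
    s = 1, so that I_q <= I_p + |Omega| (1/p - 1/q).  Given v in N_p, take phi as
    above and a multiple of phi in N_q; this gives
    m_q <= m_p + |Omega| (1/p - 1/q) ([nehari_level_lower]).  In the other
    direction fix one test function phi that is nearly optimal for q.  Its
    multiples t_p phi in N_p stay bounded as p -> q, and s^q / q - s^p / p is at
    most a quantity that tends to 0, uniformly for s in a bounded interval;
    hence limsup m_p <= m_q ([nehari_level_upper]).

    Sobolev spaces. The norm of H_0^1 is computed from a chosen weak gradient.  It
    behaves as expected because weak gradients are unique up to null sets
    ([ae_zero_of_test]) and because the classical gradient of a test function is
    a weak gradient, which rests on [integral_partial0].  The Poincare inequality
    ([poincare]) makes the norm of a nonzero v positive.  An integral with value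
    +oo is read as 0, so this positivity also shows that the integrals in the
    definition of N_p are finite on N_p ([nehari_facts]). *)

(** * The change of variable f *)

Section calculus.
Context {R : realType}.

Lemma le_of_derive_ge0 (F dF : R -> R) (a b : R) : a <= b ->
  (forall x, a <= x <= b -> is_derive x (1 : R) F (dF x)) ->
  (forall x, a <= x <= b -> 0 <= dF x) -> F a <= F b.
Proof.
move=> ab hF dF0.
have hin x : x \in `]a, b[ -> a <= x <= b.
  by rewrite in_itv/= => /andP[/ltW -> /ltW ->].
have [|c cab h] := @MVT_segment R F dF a b ab (fun x xab => hF x (hin x xab)).
  apply: derivable_within_continuous => x; rewrite in_itv/= => xab.
  by have [] := hF x xab.
by rewrite -subr_ge0 h mulr_ge0 ?subr_ge0// dF0//; rewrite in_itv/= in cab.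
Qed.

Lemma is_derive_exp (g : R -> R) (x dg : R) n : is_derive x (1 : R) g dg ->
  is_derive x (1 : R) (fun u => g u ^+ n) (n%:R * g x ^+ n.-1 * dg).
Proof.
move=> h; have -> : (fun u => g u ^+ n) = g ^+ n by apply/funext => u; rewrite fctE.
exact: is_deriveX.
Qed.

End calculus.

Section dual_change_theory.
Context {R : realType}.
Variable f : R -> R.
Hypothesis f_dual : dual_change f.

Let w (t : R) : R := Num.sqrt (1 + 2 * f t ^+ 2).

Let wsq t : w t ^+ 2 = 1 + 2 * f t ^+ 2.
Proof. by rewrite sqr_sqrtr// addr_ge0// mulr_ge0// sqr_ge0. Qed.

Let w_ge1 t : 1 <= w t.
Proof.
by rewrite -[X in X <= _]sqrtr1 ler_sqrt ?addr_ge0// ?lerDl mulr_ge0// sqr_ge0.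
Qed.

Let w_gt0 t : 0 < w t.
Proof. exact: lt_le_trans (w_ge1 t). Qed.

Lemma dual0 : f 0 = 0. Proof. by case: f_dual. Qed.

Lemma dualN t : f (- t) = - f t. Proof. by case: f_dual. Qed.

Lemma is_derive_dual (t : R) : is_derive t (1 : R) f (w t)^-1.
Proof.
have pos (u : R) : 0 <= u -> is_derive u (1:R) f (w u)^-1.
  move=> u0; case: f_dual => _ _ /(_ u u0).
  by rewrite powRN powR12_sqrt// addr_ge0// mulr_ge0// sqr_ge0.
have [/pos//|/ltW t0] := leP 0 t.
have /pos h : 0 <= - t by rewrite oppr_ge0.
have -> : f = - (f \o -%R) by apply/funext => u /=; rewrite !fctE/= dualN opprK.
have -> : w t = w (- t) by rewrite /w dualN sqrrN.
by apply: is_derive_eq; rewrite mulrN1 opprK.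
Qed.

Lemma derive1_dual t : derive1 f t = (w t)^-1.
Proof. by rewrite derive1E; apply: derive_val; exact: is_derive_dual. Qed.

Lemma continuous_dual : continuous f.
Proof.
move=> t; apply: differentiable_continuous; apply/derivable1_diffP.
by have [] := is_derive_dual t.
Qed.

Lemma dual_homo : {homo f : s t / s <= t}.
Proof.
move=> s t st; apply: (@le_of_derive_ge0 R f (fun u => (w u)^-1)) => // x _.
  exact: is_derive_dual.
by rewrite invr_ge0 ltW.
Qed.

Lemma dual_ge0 t : 0 <= t -> 0 <= f t.
Proof. by move=> t0; rewrite -dual0; apply: dual_homo. Qed.

Lemma normr_dual t : `|f t| = f `|t|.
Proof.
have [t0|/ltW t0] := leP 0 t; first by rewrite !ger0_norm// dual_ge0.
by rewrite (ler0_norm t0) dualN ler0_norm// -oppr_ge0 -dualN dual_ge0// oppr_ge0.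
Qed.

Lemma dual_le t : 0 <= t -> f t <= t.
Proof.
move=> t0; rewrite -subr_ge0.
have -> : 0 = 0 - f 0 by rewrite dual0 subr0.
apply: (@le_of_derive_ge0 R (id - f) (fun u => 1 - (w u)^-1)) => // x _.
  by apply: is_deriveB; exact: is_derive_dual.
by rewrite subr_ge0 invf_le1.
Qed.

(** f is concave on t >= 0, so its slope at t is at most that of the chord from 0;
    the factor (w t)^-1 is f'(t). *)
Lemma dual_concave t : 0 <= t -> t / w t <= f t.
Proof.
move=> t0; have [c /[!in_itv]/= /andP[c0 ct]] :=
  @MVT_segment R f (fun u => (w u)^-1) 0 t t0 (fun x _ => is_derive_dual x)
    (continuous_subspaceT continuous_dual).
rewrite dual0 !subr0 => ->; rewrite [leRHS]mulrC ler_wpM2l// lef_pV2 ?posrE//.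
rewrite ler_sqrt ?addr_ge0// ?mulr_ge0 ?sqr_ge0//.
rewrite lerD2l ler_pM2l// lerXn2r ?nnegrE ?dual_ge0 ?(le_trans c0)//.
  exact: dual_homo.
all: exact: dual_ge0 (le_trans c0 ct).
Qed.

(** The function 2 t - f(t) sqrt(1 + 2 f(t)^2) vanishes at 0 and has derivative
    (1 + 2 f(t)^2)^-1.  Equivalently t |-> f(t)^2 / t is nondecreasing: f grows at
    least like the square root. *)
Lemma dual_half t : 0 <= t -> f t <= 2 * (t / w t).
Proof.
move=> t0.
suff : f t * w t <= 2 * t by rewrite mulrA ler_pdivlMr.
rewrite -subr_ge0.
have -> : 0 = 2 * 0 - f 0 * w 0 by rewrite dual0; lra.
pose F := (fun u => 2 * u - f u * w u).
apply: (@le_of_derive_ge0 R F (fun u => (w u)^-2)) => // x _; last first.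
  by rewrite invr_ge0 exprn_ge0 ?ltW.
pose g := (fun u => 1 + 2 * f u ^+ 2).
have gE : g = cst 1 + 2 \*: (fun u => f u ^+ 2) by apply/funext.
have dg : is_derive x (1:R) g (2 * (2 * f x / w x)).
  have df2 := is_derive_exp 2 (is_derive_dual x).
  by rewrite gE; apply: is_derive_eq; rewrite add0r /= expr1 /GRing.scale/= mulrA.
have gx : 0 < g x by have := exprn_gt0 2 (w_gt0 x); rewrite wsq.
have dw : is_derive x (1:R) w (2 * f x / w x ^+ 2).
  apply: is_derive_eq.
    by apply: (@is_derive1_comp _ (@Num.sqrt R) g); apply: is_derive1_sqrt.
  have := w_gt0 x; rewrite -/(w x) => wx; field; lra.
apply: is_derive_eq.
  apply: (@is_deriveB _ _ _ (2 \*: id) (f * w)).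
  by apply: is_deriveM; exact: is_derive_dual.
rewrite /GRing.scale/=; have := w_gt0 x => wx.
have := wsq x => h.
apply: (mulfI (lt0r_neq0 (exprn_gt0 2 wx))).
transitivity (2 * w x ^+ 2 - (2 * f x ^+ 2 + w x ^+ 2)); last first.
  by rewrite divff ?lt0r_neq0 ?exprn_gt0// h; ring.
field; lra.
Qed.

Lemma dual_gt0 t : 0 < t -> 0 < f t.
Proof. by move=> t0; rewrite (lt_le_trans _ (dual_concave (ltW t0)))// divr_gt0. Qed.

Lemma dual_derive_homo x y : 0 <= x -> x <= y -> f x / w x <= f y / w y.
Proof.
move=> x0 xy; have y0 := le_trans x0 xy.
rewrite ler_pdivrMr// mulrAC ler_pdivlMr//.
have fx0 := dual_ge0 x0; have fy0 := dual_ge0 y0; have fxy := dual_homo xy.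
rewrite -(@ler_pXn2r _ 2) ?nnegrE ?mulr_ge0// ?(ltW (w_gt0 _))// !exprMn !wsq.
have : f x ^+ 2 <= f y ^+ 2 by rewrite ler_pXn2r.
nra.
Qed.

(** Monotonicity of f(x)^2 / x, in a form that makes sense at x = 0. *)
Lemma dual_sqr_homo x y : 0 <= x -> x <= y -> f x ^+ 2 * y <= f y ^+ 2 * x.
Proof.
move=> x0 xy; rewrite -subr_ge0.
have -> : 0 = f x ^+ 2 * x - f x ^+ 2 * x by rewrite subrr.
pose F u := f u ^+ 2 * x - f x ^+ 2 * u.
apply: (@le_of_derive_ge0 _ F (fun u => 2 * (f u / w u) * x - f x ^+ 2)) => //.
  move=> u _; have df := is_derive_dual u.
  have dfn := is_derive_exp 2 df.
  rewrite (_ : F = x \*: (fun u => f u ^+ 2) - (f x ^+ 2) \*: id); last first.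
    by apply/funext => v; rewrite /F !fctE/= /GRing.scale/= mulrC.
  apply: is_derive_eq; rewrite /GRing.scale/= mulr1; ring.
move=> u /andP[xu uy]; rewrite subr_ge0.
apply: (@le_trans _ _ (f x * (2 * (x / w x)))).
  by rewrite expr2 ler_wpM2l ?dual_ge0// dual_half.
have -> : f x * (2 * (x / w x)) = 2 * (f x / w x) * x by ring.
by rewrite ler_wpM2r// ler_pM2l// dual_derive_homo.
Qed.

(* k is the derivative of f^4 / 4. *)
Let k x := f x ^+ 3 / w x.

Let k_homo x y : 0 <= x -> x <= y -> k x * y <= k y * x.
Proof.
move=> x0 xy; have y0 := le_trans x0 xy.
have -> : k x * y = (f x / w x) * (f x ^+ 2 * y) by rewrite /k; field; exact: lt0r_neq0.
have -> : k y * x = (f y / w y) * (f y ^+ 2 * x) by rewrite /k; field; exact: lt0r_neq0.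
apply: ler_pM; rewrite ?mulr_ge0 ?invr_ge0 ?sqr_ge0 ?dual_ge0 ?(ltW (w_gt0 _))//.
  exact: dual_derive_homo.
exact: dual_sqr_homo.
Qed.

(** For p = 4, the function r |-> f(sqrt r)^4 is convex because k(x) / x is
    nondecreasing; this is its tangent inequality at r = s^2. *)
Lemma dual_pow4_convex s t : 0 < s -> 0 <= t ->
  f s ^+ 4 * s + 2 * (t ^+ 2 - s ^+ 2) * (f s ^+ 3 / w s) <= f t ^+ 4 * s.
Proof.
move=> s0 t0; rewrite -/(k s) -subr_ge0.
pose F u := f u ^+ 4 * s - f s ^+ 4 * s - 2 * (u ^+ 2 - s ^+ 2) * k s.
have dF (u : R) : is_derive u (1 : R) F (4 * (k u * s - k s * u)).
  have d4 := is_derive_exp 4 (is_derive_dual u).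
  have d2 := is_derive_exp 2 (is_derive_id u (1 : R)).
  rewrite (_ : F = s \*: (fun u => f u ^+ 4) - (2 * k s) \*: (fun u => id u ^+ 2)
    + cst (2 * s ^+ 2 * k s - f s ^+ 4 * s)); last first.
    by apply/funext => v; rewrite /F !fctE/= /GRing.scale/=; ring.
  by apply: is_derive_eq; rewrite /GRing.scale/= /k; ring.
have -> : f t ^+ 4 * s - (f s ^+ 4 * s + 2 * (t ^+ 2 - s ^+ 2) * k s) = F t.
  by rewrite /F; ring.
have F0 : F s = 0 by rewrite /F; ring.
have [st|/ltW ts] := leP s t.
  rewrite -F0; apply: le_of_derive_ge0 (fun u _ => dF u) _ => // u /andP[su _].
  by rewrite pmulr_rge0// subr_ge0 k_homo// ltW.
have dFN (u : R) : is_derive u (1 : R) (- F) (- (4 * (k u * s - k s * u))).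
  exact: is_deriveN.
rewrite -oppr_le0 (_ : 0 = (- F) s); last by rewrite fctE F0 oppr0.
have -> : - F t = (- F) t by [].
apply: le_of_derive_ge0 (fun u _ => dFN u) _ => // u /andP[tu us].
by rewrite oppr_ge0 pmulr_rle0// subr_le0 k_homo// (le_trans t0).
Qed.

(** The density of the nonlinear part of I_p'(v)[v]. *)
Definition nonlin p s := `|f s| `^ (p - 2) * f s * derive1 f s * s.

Lemma nonlinN p s : nonlin p (- s) = nonlin p s.
Proof.
rewrite /nonlin !derive1_dual dualN normrN /w dualN sqrrN; ring.
Qed.

Lemma powR_natD (y r : R) n : 0 <= y -> r + n%:R != 0 ->
  y `^ (r + n%:R) = y `^ r * y ^+ n.
Proof. by move=> y0 rn; rewrite powRD ?powR_mulrn//; apply/implyP => /eqP; move/eqP: rn. Qed.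

Lemma nonlin_ge0 p s : 0 <= nonlin p s.
Proof.
have pos u : 0 <= u -> 0 <= nonlin p u.
  move=> u0; rewrite /nonlin derive1_dual !mulr_ge0 ?powR_ge0 ?dual_ge0//.
  by rewrite invr_ge0 ltW.
have [/pos//|/ltW s0] := leP 0 s.
by rewrite -nonlinN pos// oppr_ge0.
Qed.

(** The inequalities f(s) / 2 <= s f'(s) <= f(s), multiplied by f(s)^(p-1) for s >= 0. *)
Lemma nonlin_bounds p s : 0 < p ->
  `|f s| `^ p / 2 <= nonlin p s <= `|f s| `^ p.
Proof.
move=> p0.
have pos u : 0 <= u -> `|f u| `^ p / 2 <= nonlin p u <= `|f u| `^ p.
  move=> u0; rewrite /nonlin derive1_dual ger0_norm ?dual_ge0//.
  have -> : f u `^ p = f u `^ (p - 2) * (f u * f u).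
    rewrite -expr2 -powR_natD ?dual_ge0 ?subrK// ?lt0r_neq0//.
  have h1 := dual_concave u0; have h2 := dual_half u0; have h0 := dual_ge0 u0.
  have -> : f u `^ (p - 2) * f u / w u * u = f u `^ (p - 2) * (f u * (u / w u)) by ring.
  rewrite -mulrA !ler_wpM2l ?powR_ge0//=.
  have -> : f u * f u / 2 = f u * (f u / 2) by ring.
  by rewrite ler_wpM2l// ler_pdivrMr// mulrC.
have [/pos//|/ltW s0] := leP 0 s.
rewrite -nonlinN (_ : `|f s| = `|f (- s)|) ?pos ?oppr_ge0//.
by rewrite dualN normrN.
Qed.

(** The case p = 4 is [dual_pow4_convex]; with y = f(s) and z = f(t s), Young's
    inequality y^(p-4) z^4 <= (4/p) z^p + (1 - 4/p) y^p carries it to p > 4. *)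
Lemma dual_pow_convex p s t : 4 < p -> 0 <= t ->
  `|f s| `^ p / p + (t ^+ 2 - 1) / 2 * nonlin p s <= `|f (t * s)| `^ p / p.
Proof.
move=> p4 t0; have p0 : 0 < p by apply: lt_trans p4.
have pos u : 0 < u ->
    `|f u| `^ p / p + (t ^+ 2 - 1) / 2 * nonlin p u <= `|f (t * u)| `^ p / p.
  move=> u0; have tu0 : 0 <= t * u by rewrite mulr_ge0// ltW.
  rewrite /nonlin derive1_dual !ger0_norm ?dual_ge0 ?(ltW u0)//.
  set y := f u; set z := f (t * u).
  have y0 : 0 < y by exact: dual_gt0.
  have z0 : 0 <= z by exact: dual_ge0.
  have h4 : y ^+ 4 + 2 * (t ^+ 2 - 1) * (y ^+ 3 * (u / w u)) <= z ^+ 4.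
    rewrite -(ler_pM2r u0); apply: le_trans (dual_pow4_convex u0 tu0).
    by rewrite le_eqVlt; apply/orP; left; apply/eqP; rewrite -/y; ring.
  have young : z ^+ 4 * y `^ (p - 4) <= (4 / p) * z `^ p + (1 - 4 / p) * y `^ p.
    have zp : (z ^+ 4) `^ (p / 4) = z `^ p.
      by rewrite -powR_mulrn// -powRrM; congr (_ `^ _); field.
    have yp : (y `^ (p - 4)) `^ (p / (p - 4)) = y `^ p.
      rewrite -powRrM; congr (_ `^ _); field; lra.
    have := @conjugate_powR R (z ^+ 4) (y `^ (p - 4)) (p / 4) (p / (p - 4)).
    rewrite zp yp exprn_ge0// powR_ge0 !divr_gt0 ?subr_gt0// => /(_ isT isT isT isT).
    rewrite !invf_div => h; apply: (le_trans (h _)); first by field; lra.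
    rewrite le_eqVlt; apply/orP; left; apply/eqP; field; lra.
  have yp : y `^ p = y `^ (p - 4) * y ^+ 4.
    by rewrite -powR_natD ?ltW// ?subrK// lt0r_neq0.
  have yp2 : y `^ (p - 2) = y `^ (p - 4) * y ^+ 2.
    rewrite -powR_natD ?ltW//; first by congr (_ `^ _); ring.
    by rewrite lt0r_neq0//; lra.
  set c := y `^ (p - 4) in young yp yp2; have c0 : 0 <= c by exact: powR_ge0.
  have := ler_wpM2l c0 h4 => {}h4.
  rewrite yp2.
  have four0 : 0 < 4 :> R by [].
  rewrite -(ler_pM2l four0).
  have -> : 4 * (z `^ p / p) = (4 / p) * z `^ p by ring.
  apply: le_trans (_ : c * z ^+ 4 - (1 - 4 / p) * y `^ p <= _); last lra.
  apply: le_trans (lerB h4 (lexx _)).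
  rewrite le_eqVlt; apply/orP; left; apply/eqP; rewrite yp.
  by field; rewrite !lt0r_neq0.
have [s0|s0|<-] := ltgtP 0 s; first exact: pos.
  have := pos (- s); rewrite oppr_gt0 mulrN nonlinN !dualN !normrN; exact.
by rewrite /nonlin !mulr0 dual0 addr0.
Qed.

Lemma dual_growth p s : 0 < p -> 1 <= `|s| ->
  (f 1 ^+ 2 * `|s|) `^ (p / 2) <= `|f s| `^ p.
Proof.
move=> p0 s1; rewrite normr_dual.
have -> : f `|s| `^ p = (f `|s| ^+ 2) `^ (p / 2).
  by rewrite -powR_mulrn ?dual_ge0// -powRrM; congr (_ `^ _); field.
apply: ge0_ler_powR.
- by rewrite divr_ge0// ltW.
- by rewrite nnegrE mulr_ge0// sqr_ge0.
- by rewrite nnegrE sqr_ge0.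
by have := dual_sqr_homo ler01 s1; rewrite mulr1.
Qed.

Lemma dual_norm_le s : `|f s| <= `|s|.
Proof. by rewrite normr_dual dual_le. Qed.

End dual_change_theory.

Section power_inequalities.
Context {R : realType}.

(** The left-hand side is largest at s = 1: Young's inequality for s^p and 1. *)
Lemma powR_div_le (p q s : R) : 0 < p -> p < q -> 0 <= s ->
  s `^ p / p - s `^ q / q <= p^-1 - q^-1.
Proof.
move=> p0 pq s0; have q0 := lt_trans p0 pq.
have := @conjugate_powR R (s `^ p) 1 (q / p) (q / (q - p)) (powR_ge0 _ _) ler01.
rewrite !divr_gt0 ?subr_gt0// => /(_ isT isT).
have -> : (s `^ p) `^ (q / p) = s `^ q.
  by rewrite -powRrM; congr (_ `^ _); field; rewrite lt0r_neq0.
rewrite powR1 mulr1 !invf_div => h.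
have {h} : s `^ p <= s `^ q * (p / q) + 1 * ((q - p) / q).
  by apply: h; field; rewrite lt0r_neq0.
have ip0 : 0 < p^-1 by rewrite invr_gt0.
rewrite -(ler_pM2r ip0) => h.
rewrite lerBlDr (le_trans h)// le_eqVlt; apply/orP; left; apply/eqP.
by field; rewrite !lt0r_neq0.
Qed.

(** The bound tends to 0 as p -> q with M fixed. *)
Lemma powR_div_le_bounded (p q s M : R) : 0 < p -> p < q -> 1 <= M -> 0 <= s <= M ->
  s `^ q / q - s `^ p / p <= M `^ q / q * (1 - M `^ (p - q)).
Proof.
move=> p0 pq M1 /andP[s0 sM]; have q0 := lt_trans p0 pq.
have M0 : 0 < M by apply: lt_le_trans M1.
have [->|sn0] := eqVneq s 0.
  rewrite !powR0 ?lt0r_neq0// !mul0r subr0 mulr_ge0 ?divr_ge0 ?powR_ge0 ?(ltW q0)//.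
  by rewrite subr_ge0 -[leRHS](powRr0 M) ler_powR// subr_le0 ltW.
have s_gt0 : 0 < s by rewrite lt_neqAle eq_sym sn0.
have sqE : s `^ p = s `^ q * s `^ (p - q).
  by rewrite -powRD ?sn0 ?implybT// addrC subrK.
have h1 : M `^ (p - q) <= s `^ (p - q).
  rewrite -(opprB q) !powRN lef_pV2 ?posrE ?powR_gt0//.
  by apply: ge0_ler_powR; rewrite ?nnegrE ?subr_ge0 ?(ltW pq) ?(ltW M0).
have h2 : M `^ (p - q) <= 1.
  by rewrite -[leRHS](powRr0 M) ler_powR// subr_le0 ltW.
apply: (@le_trans _ _ (s `^ q / q * (1 - M `^ (p - q)))).
  rewrite mulrBr mulr1 lerB// sqE -mulrA.
  rewrite -mulrA ler_wpM2l ?powR_ge0// mulrC.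
  by apply: ler_pM; rewrite ?powR_ge0 ?invr_ge0 ?(ltW q0)// lef_pV2// ltW.
rewrite ler_wpM2r ?subr_ge0// ler_wpM2r ?invr_ge0 ?(ltW q0)//.
by apply: ge0_ler_powR; rewrite ?nnegrE ?(ltW q0) ?(ltW M0).
Qed.
End power_inequalities.

(** * Cubes, open sets and Lebesgue measure in R^n *)

Section rV_topology.
Context {R : realType} {n : nat}.
Implicit Types (x y : 'rV[R]_n).

Lemma normr_coord_le x i : `|x ord0 i| <= `|x|.
Proof.
rewrite [leRHS]mx_normrE.
exact: (le_bigmax _ (fun ij => `|x ij.1 ij.2|) (ord0, i)).
Qed.

Definition cube (r : R) : set 'rV[R]_n := [set x | forall i, `|x ord0 i| <= r].

Lemma bounded_cube (A : set 'rV[R]_n) : bounded_set A ->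
  exists2 r, 0 < r & A `<=` cube r.
Proof.
move=> [M [_ h]]; pose r := Num.max M 0 + 1.
have Mr : M < r by rewrite ltr_pwDr// le_max lexx.
exists r; first by rewrite ltr_pwDr// le_max lexx orbT.
by move=> x Ax i; apply: le_trans (normr_coord_le x i) (h _ Mr _ Ax).
Qed.

Definition open_cube x (r : R) : set 'rV[R]_n :=
  [set y | forall i, `|y ord0 i - x ord0 i| < r].

Definition closed_cube x (r : R) : set 'rV[R]_n :=
  [set y | forall i, `|y ord0 i - x ord0 i| <= r].

Lemma nbhs_open_cube x (A : set 'rV[R]_n) : nbhs x A ->
  exists2 r, 0 < r & open_cube x r `<=` A.
Proof.
rewrite -nbhs_ballE => -[r/= r0 h]; exists r => // y xy; apply: h.
by split=> // i j; rewrite ord1 /ball/= -normrN opprB; exact: xy.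
Qed.

Definition rat_vec (c : 'rV[rat]_n) : 'rV[R]_n := map_mx ratr c.

(** The closed cubes stay inside A, so that bump functions supported in the cubes
    are test functions on A. *)
Lemma open_bigcup_open_cube (A : set 'rV[R]_n) : open A ->
  A = \bigcup_(ck in [set ck : 'rV[rat]_n * nat |
        closed_cube (rat_vec ck.1) ck.2.+1%:R^-1 `<=` A])
      open_cube (rat_vec ck.1) ck.2.+1%:R^-1.
Proof.
move=> oA; apply/seteqP; split; last first.
  by move=> y [ck h yck]; apply: h => i; exact: ltW.
move=> x Ax; have [r r0 xr] := nbhs_open_cube (open_nbhs_nbhs (conj oA Ax)).
have [k kr] : exists k : nat, k.+1%:R^-1 < r / 2.
  have h : 0 < r / 2 by rewrite divr_gt0.
  have [k _ /(_ k (leqnn k)) kr] := near_infty_natSinv_lt (PosNum h).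
  by exists k.
have k0 : 0 < k.+1%:R^-1 :> R by rewrite invr_gt0.
set e : R := k.+1%:R^-1 in kr k0.
have /choice[c hc] : forall i, exists q : rat, `|x ord0 i - ratr q| < e.
  move=> i; have /rat_in_itvoo[q] : x ord0 i - e < x ord0 i + e.
    by rewrite ltrBlDr -addrA ltrDl addr_gt0.
  rewrite in_itv/= => /andP[h1 h2]; exists q.
  by rewrite ltr_norml; apply/andP; split; lra.
exists (\row_i c i, k) => /=; last first.
  by move=> i; rewrite /rat_vec !mxE; exact: hc.
move=> y hy; apply: xr => i; have := hy i; have := hc i.
rewrite /rat_vec !mxE -/e => h1 h2.
rewrite -(subrKA (ratr (c i))) (le_lt_trans (ler_normD _ _))//.
rewrite [X in _ + X]distrC; lra.
Qed.

Lemma measurable_open_cube x r : measurable (open_cube x r).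
Proof.
rewrite (_ : open_cube x r = \bigcap_(i in [set: 'I_n])
   ((fun y : 'rV[R]_n => y ord0 i) @^-1` `]x ord0 i - r, x ord0 i + r[)); last first.
  by apply/seteqP; split=> y h i; have := h i; rewrite /= in_itv/= ltr_distl; move=> ->.
apply: fin_bigcap_measurable => [|i _]; first exact: finite_finset.
have := @measurable_coord_rV R n i measurableT `]x ord0 i - r, x ord0 i + r[%classic.
by rewrite setTI; apply.
Qed.

Lemma open_measurable_rV (A : set 'rV[R]_n) : open A -> measurable A.
Proof.
move=> /open_bigcup_open_cube ->; rewrite bigcup_mkcond.
apply: countable_bigcupT_measurable; first exact: countableP.
by move=> ck; case: ifPn => // _; exact: measurable_open_cube.
Qed.

Lemma continuous_measurable_rV (u : 'rV[R]_n -> R) (D : set 'rV[R]_n) :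
  measurable D -> continuous u -> measurable_fun D u.
Proof.
move=> mD /continuousP cu; apply: (@measurable_funS _ _ _ _ setT) => //.
apply: (measurability _ (RGenOpens.measurableE R)).
move=> _ [_ [a [b ->] <-]]; rewrite setTI; apply: open_measurable_rV.
exact/cu/interval_open.
Qed.

End rV_topology.

Section lebesgue_rV_theory.
Context {R : realType}.

Lemma measurable_cube n (r : R) : measurable (@cube R n r).
Proof.
rewrite (_ : cube r = \bigcap_(i in [set: 'I_n])
   ((fun y : 'rV[R]_n => y ord0 i) @^-1` `[- r, r])); last first.
  by apply/seteqP; split=> y h i; have := h i; rewrite /= in_itv/= ler_norml//; move=> ->.
apply: fin_bigcap_measurable => [|i _]; first exact: finite_finset.
have := @measurable_coord_rV R n i measurableT `[- r, r]%classic.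
by rewrite setTI; apply.
Qed.

(** A cube of R^(n+1) is the image of an interval times a cube of R^n. *)
Lemma lebesgue_rV_cube n (r : R) : (lebesgue_rV R n (@cube R n r) < +oo)%E.
Proof.
elim: n => [|n IH].
  by rewrite /= diracE; case: (_ \in _); rewrite ltry.
rewrite /= /lebesgue_rV_step /pushforward.
rewrite (_ : _ @^-1` _ = (`[- r, r] `*` @cube R n r)); last first.
  apply/seteqP; split=> [[s y]/= h|[s y]/= [s0 h] i].
    split; first by have := h ord0; rewrite cons_rV0/= in_itv/= ler_norml.
    by move=> i; have := h (lift ord0 i); rewrite cons_rVS.
  by have [j ->|->] := unliftP ord0 i; rewrite ?cons_rVS ?cons_rV0//=;
    move: s0; rewrite in_itv/= ler_norml.
rewrite product_measure1E//=; last exact: measurable_cube.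
rewrite lte_mul_pinfty ?measure_ge0//.
  by rewrite lebesgue_measure_itv/=; case: ifP.
Qed.

End lebesgue_rV_theory.

(** * The integral of a partial derivative vanishes *)

Section calculus_rV.
Context {R : realType}.

Lemma continuous_to_rV (T : topologicalType) n (g : T -> 'rV[R]_n) :
  (forall i, continuous (fun t => g t ord0 i)) -> continuous g.
Proof.
move=> cg t A /nbhs_open_cube[r r0 rA].
have : \forall s \near t, forall i, `|g s ord0 i - g t ord0 i| < r.
  apply: (@filter_forall _ _ (fun i s => `|g s ord0 i - g t ord0 i| < r)) => i.
  by have /cvgr_distC_lt/(_ r r0) := cg i t.
by apply: filterS => s h; exact: rA.
Qed.

Lemma cube_closed n (r : R) : closed (@cube R n r).
Proof.
rewrite (_ : cube r = \bigcap_(i in [set: 'I_n])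
   ((fun y : 'rV[R]_n => y ord0 i) @^-1` `[- r, r])); last first.
  by apply/seteqP; split=> y h i; have := h i; rewrite /= in_itv/= ler_norml//; move=> ->.
apply: closed_bigI => i _.
apply: (@preimage_closed _ _ (fun y : 'rV[R]_n => y ord0 i) `[- r, r]%classic)
  => [y _|]; last exact: itv_closed.
exact: coord_continuous.
Qed.

Lemma cube_bounded n (r : R) : bounded_set (@cube R n r).
Proof.
exists `|r|; split=> // M rM x xr /=.
rewrite [leLHS]mx_normrE; apply/bigmax_leP; split=> [|[j i] _ /=].
  exact: le_trans (ltW rM).
by rewrite ord1 (le_trans (xr i))// (le_trans (ler_norm _))// ltW.
Qed.

Lemma compact_cube n (r : R) : compact (@cube R n r).
Proof. by apply: bounded_closed_compact; [exact: cube_bounded|exact: cube_closed]. Qed.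

Lemma compactly_supported_bounded n (K : set 'rV[R]_n) (u : 'rV[R]_n -> R) :
  compact K -> continuous u -> (forall x, ~ K x -> u x = 0) ->
  exists2 C : R, 0 < C & forall x, `|u x| <= C.
Proof.
move=> cK cu u0.
have /compact_bounded[M [_ h]] := continuous_compact (continuous_subspaceT cu) cK.
pose C := Num.max M 0 + 1; have C0 : 0 < C by rewrite ltr_pwDr// le_max lexx orbT.
exists C => // x; have [Kx|/u0 ->] := pselect (K x); last by rewrite normr0 ltW.
by apply: (h C); rewrite ?ltr_pwDr ?le_max ?lexx//; exists x.
Qed.

Lemma partial_outside n i (K : set 'rV[R]_n) (u : 'rV[R]_n -> R) :
  closed K -> (forall x, ~ K x -> u x = 0) ->
  forall x, ~ K x -> partial i u x = 0.
Proof.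
move=> cK u0 x Kx; rewrite /partial.
rewrite (near_eq_derive (g := cst 0)); first exact: derive_cst.
have : nbhs x (~` K) by apply: open_nbhs_nbhs; split => //; exact: closed_openC.
by apply: filterS => y /u0.
Qed.

(** A directional derivative depends only on the restriction of the function to a
    line, so it can be computed on any other parametrization of that line. *)
Lemma derive_transport (V W : normedModType R) (F : V -> R) (G : W -> R) a v b w :
  (forall h, F (h *: v + a) = G (h *: w + b)) ->
  (derivable F a v <-> derivable G b w) * ('D_v F a = 'D_w G b).
Proof.
move=> FG.
have E : (fun h => h^-1 *: ((F \o shift a) (h *: v) - F a)) =
    (fun h => h^-1 *: ((G \o shift b) (h *: w) - G b)).
  apply/funext => h /=; rewrite FG.
  by have := FG 0; rewrite !scale0r !add0r => ->.
by rewrite /derivable /derive E.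
Qed.

Lemma continuous_cons_rVl n (y : 'rV[R]_n) :
  continuous (fun s : R => cons_rV (s, y)).
Proof.
apply: continuous_to_rV => i; have [j ->|->] := unliftP ord0 i.
  by under eq_fun do rewrite cons_rVS/=; exact: cst_continuous.
by under eq_fun do rewrite cons_rV0/=; move=> s; exact: cvg_id.
Qed.

Lemma continuous_cons_rVr n (s : R) :
  continuous (fun y : 'rV[R]_n => cons_rV (s, y)).
Proof.
apply: continuous_to_rV => i; have [j ->|->] := unliftP ord0 i.
  by under eq_fun do rewrite cons_rVS/=; exact: coord_continuous.
by under eq_fun do rewrite cons_rV0/=; exact: cst_continuous.
Qed.

Lemma cons_rV_addl n (h s : R) (y : 'rV[R]_n) :
  cons_rV (h *: (1 : R) + s, y) = h *: delta_mx ord0 ord0 + cons_rV (s, y).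
Proof.
apply/rowP => i; have [j ->|->] := unliftP ord0 i.
  by rewrite [RHS]mxE !cons_rVS/= [X in X + _]mxE [delta_mx _ _ _ _]mxE/= mulr0 add0r.
by rewrite [RHS]mxE !cons_rV0/= [X in _ = X + _]mxE [delta_mx _ _ _ _]mxE/=.
Qed.

Lemma cons_rV_addr n (h s : R) (y : 'rV[R]_n) j :
  cons_rV (s, h *: delta_mx ord0 j + y) =
  h *: delta_mx ord0 (lift ord0 j) + cons_rV (s, y).
Proof.
apply/rowP => i; have [k ->|->] := unliftP ord0 i.
  by rewrite [RHS]mxE !cons_rVS/= !mxE/= (inj_eq lift_inj).
by rewrite [RHS]mxE !cons_rV0/= [X in _ = X + _]mxE [delta_mx _ _ _ _]mxE/= mulr0 add0r.
Qed.

Lemma integrable_supp n (r : R) (u : 'rV[R]_n -> R) :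
  continuous u -> (forall x, ~ cube r x -> u x = 0) ->
  (lebesgue_rV R n).-integrable setT (EFin \o u).
Proof.
move=> cu u0; have mr := @measurable_cube R n r.
have mu : measurable_fun setT u by exact: continuous_measurable_rV.
have -> : EFin \o u = (EFin \o u) \_ (cube r).
  apply/funext => x; rewrite patchE; case: ifPn => //.
  by rewrite notin_setE /= => /u0 ->.
apply/integrable_restrict => //; rewrite setTI.
apply: measurable_bounded_integrable => //; first exact: lebesgue_rV_cube.
  exact: measurable_funTS.
have [C C0 uC] := compactly_supported_bounded (@compact_cube n r) cu u0.
exists C; split=> [|M CM x _]; first exact: num_real.
by rewrite /= (le_trans (uC x))// ltW.
Qed.

Lemma integral_lebesgue_rVS n (u : 'rV[R]_n.+1 -> R) :
  measurable_fun setT u ->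
  (lebesgue_rV R n.+1).-integrable setT (EFin \o u) ->
  (@lebesgue_measure R \x lebesgue_rV R n)%E.-integrable setT
    (fun p => (u (cons_rV p))%:E) /\
  (\int[lebesgue_rV R n.+1]_x (u x)%:E =
   \int[@lebesgue_measure R \x lebesgue_rV R n]_p (u (cons_rV p))%:E)%E.
Proof.
move=> mu iu; have mc := @measurable_cons_rV R n.
have /measurable_EFinP mu' := mu.
have ip : (@lebesgue_measure R \x lebesgue_rV R n)%E.-integrable setT
    (fun p => (u (cons_rV p))%:E).
  apply/integrableP; split; first exact: (measurableT_comp mu' mc).
  move/integrableP : iu => [_].
  rewrite (@eq_measure_integral _ _ _ setT
    (pushforward (@lebesgue_measure R \x lebesgue_rV R n)%E (@cons_rV R n)))//.
  rewrite ge0_integral_pushforward//.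
  by apply: measurableT_comp.
split => //.
rewrite (@eq_measure_integral _ _ _ setT
    (pushforward (@lebesgue_measure R \x lebesgue_rV R n)%E (@cons_rV R n)))//.
by rewrite integral_pushforward// ?preimage_setT.
Qed.

Lemma integral_derive1_supp (F : R -> R) (r : R) : 0 < r ->
  (forall s, derivable F s 1) -> continuous (derive1 F) ->
  (forall s, r < `|s| -> F s = 0) ->
  (\int[lebesgue_measure]_s (derive1 F s)%:E = 0)%E.
Proof.
move=> r0 dF cdF F0.
have cF : continuous F.
  by move=> s; apply: differentiable_continuous; apply/derivable1_diffP.
have dF0 s : r < `|s| -> derive1 F s = 0.
  move=> rs; rewrite derive1E (near_eq_derive (g := cst 0)); first exact: derive_cst.
  have h := @cvgr_norm_gt R R R (nbhs s) _ id s cvg_id r rs.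
  by near=> t; apply: F0; near: t; exact: h.
pose b := r + 1; have rb : r < b by rewrite ltrDl.
have b0 : 0 < b by exact: lt_trans rb.
have -> : (\int[lebesgue_measure]_s (derive1 F s)%:E =
           \int[lebesgue_measure]_(s in `[(- b)%R, b]) (derive1 F s)%:E)%E.
  rewrite [RHS]integral_mkcond; apply: eq_integral => s _; rewrite patchE.
  case: ifPn => //; rewrite notin_setE/= in_itv/= -ler_norml => /negP.
  by rewrite -ltNge => bs; rewrite dF0// (lt_trans rb).
have -> : (\int[lebesgue_measure]_(s in `[(- b)%R, b]) (derive1 F s)%:E =
           (F b)%:E - (F (- b))%:E)%E.
  apply: continuous_FTC2 => //; first by rewrite (lt_trans _ b0)// oppr_lt0.
    exact: continuous_subspaceT.
  by split=> //; [apply: cvg_at_right_filter|apply: cvg_at_left_filter]; exact: cF.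
by rewrite !F0 ?subee// ?normrN gtr0_norm.
Unshelve. all: by end_near.
Qed.

(** Induction on the dimension with Fubini's theorem: along the first coordinate
    the inner integral vanishes by the fundamental theorem of calculus, and for any
    other direction the slices of psi satisfy the induction hypothesis. *)
Theorem integral_partial0 n (i : 'I_n) (r : R) (psi : 'rV[R]_n -> R) : 0 < r ->
  continuous psi -> (forall x, derivable psi x (delta_mx ord0 i)) ->
  continuous (partial i psi) -> (forall x, ~ cube r x -> psi x = 0) ->
  (\int[lebesgue_rV R n]_x (partial i psi x)%:E = 0)%E.
Proof.
move=> r0; elim: n i psi => [[]//|n IH] i psi cpsi dpsi cdpsi psi0.
have dpsi0 := @partial_outside _ i _ _ (@cube_closed _ r) psi0.
have [|ip ->] := @integral_lebesgue_rVS n _ _ (integrable_supp cdpsi dpsi0).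
  exact: continuous_measurable_rV.
have [j ij|i0] := unliftP ord0 i.
  rewrite -integral12_prod_meas1// integral0_eq// => s _; rewrite /fubini_F/=.
  have h y := @derive_transport 'rV[R]_n 'rV[R]_n.+1 (fun y => psi (cons_rV (s, y)))
    psi y (delta_mx ord0 j) _ _ (fun k => f_equal psi (cons_rV_addr k s y j)).
  rewrite -[RHS](IH j (fun y => psi (cons_rV (s, y)))).
  - by apply: eq_integral => y _; rewrite /partial ij -h.
  - move=> y; apply: continuous_comp; last exact: cpsi.
    exact: continuous_cons_rVr.
  - by move=> y; apply/(h y).1; rewrite -ij.
  - rewrite (_ : partial _ _ = partial i psi \o (fun y => cons_rV (s, y))).
      by move=> y; apply: continuous_comp; [exact: continuous_cons_rVr|exact: cdpsi].
    by apply/funext => y; rewrite /partial ij/= -h.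
  - move=> y ny; apply: psi0 => sy; apply: ny => k.
    by have := sy (lift ord0 k); rewrite cons_rVS.
rewrite -integral21_prod_meas1// integral0_eq// => y _; rewrite /fubini_G/=.
have h s := @derive_transport R 'rV[R]_n.+1 (fun s => psi (cons_rV (s, y)))
  psi s 1 _ _ (fun k => f_equal psi (cons_rV_addl k s y)).
pose F s := psi (cons_rV (s, y)).
have dFE s : derive1 F s = partial i psi (cons_rV (s, y)).
  by rewrite derive1E h /partial i0.
under eq_integral do rewrite -dFE.
apply: integral_derive1_supp r0 _ _ _.
- by move=> s; apply/(h s).1; rewrite -i0.
- rewrite (_ : derive1 F = partial i psi \o (fun s => cons_rV (s, y))).
    by move=> s; apply: continuous_comp; [exact: continuous_cons_rVl|exact: cdpsi].
  by apply/funext.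
- move=> s rs; apply: psi0 => /(_ ord0); rewrite cons_rV0/=.
  by apply/negP; rewrite -ltNge.
Qed.

End calculus_rV.

(** * Smooth bump functions *)

Section flat.
Context {R : realType}.

(** The functions x^-k exp(-1/x), extended by 0 to x <= 0: they are closed under
    differentiation up to linear combinations, hence smooth. *)
Definition flat (k : nat) (x : R) : R :=
  if 0 < x then x^-1 ^+ k * expR (- x^-1) else 0.

Lemma flat_ge0 k x : 0 <= flat k x.
Proof.
rewrite /flat; case: ifPn => // x0.
by rewrite mulr_ge0 ?expR_ge0// exprn_ge0// invr_ge0 ltW.
Qed.

(** From y^(k+1) / (k+1)! <= exp y at y = 1/x; it gives the continuity of flat at
    0 and, applied to k + 1, its differentiability there. *)
Lemma flat_le k x : flat k x <= (k.+1)`!%:R * `|x|.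
Proof.
rewrite /flat; case: ifPn => x0; last by rewrite mulr_ge0.
have y0 : 0 < x^-1 by rewrite invr_gt0.
have fact0 : 0 < (k.+1)`!%:R :> R by rewrite ltr0n fact_gt0.
rewrite expRN ler_pdivrMr ?expR_gt0// gtr0_norm//.
have := @expR_ge1Dxn _ x^-1 k (ltW y0).
set E := expR _; set c := _`!%:R => h.
have {}h : x^-1 ^+ k.+1 <= c * E.
  rewrite mulrC -ler_pdivrMr// (le_trans _ h)// lerDr//.
rewrite -(ler_pM2l y0) -exprS (le_trans h)// le_eqVlt; apply/orP; left.
by apply/eqP; field; exact: lt0r_neq0.
Qed.

Lemma is_derive_flat k x :
  is_derive x (1 : R) (flat k) (flat k.+2 x - k%:R * flat k.+1 x).
Proof.
have [x0|x0|->] := ltgtP x 0.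
- apply: (@near_eq_is_derive _ _ _ (cst 0)).
    near=> y; rewrite /flat ltNge ltW//.
    by near: y; exact: lt_nbhsl.
  by apply: is_derive_eq; rewrite /flat ltNge ltW//= mulr0 subr0.
- apply: (@near_eq_is_derive R R R (fun y : R => y^-1 ^+ k * expR (- y^-1))).
    near=> y; rewrite /flat ifT//.
    by near: y; exact: lt_nbhsr.
  have xn0 := lt0r_neq0 x0.
  have dV : is_derive x (1 : R) (fun y : R => y^-1) (- x ^- 2).
    apply: is_derive_eq; first by apply: (@is_deriveV _ id).
    by rewrite /GRing.scale/= mulr1.
  have dX := is_derive_exp k dV.
  have dE : is_derive x (1 : R) (fun y : R => expR (- y^-1)) (expR (- x^-1) * x ^- 2).
    apply: (@is_derive_eq _ _ _ _ _ _ _ (expR (- x^-1) * - - x ^- 2)); last by rewrite opprK.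
  apply: is_derive_eq; rewrite /flat x0 /GRing.scale/= -!exprVn.
  case: k {dX} => [|k]; first by rewrite !mul0r; ring.
  by rewrite /= !exprS; ring.
- have h0 : (h^-1 *: ((flat k \o shift 0) (h *: 1) - flat k 0) : R) @[h --> 0^'] --> (0 : R).
    apply/cvgr0Pnorm_lt => e e0; near=> h.
    rewrite /= addr0 [flat k 0]/flat ltxx subr0 /GRing.scale/= mulr1.
    have -> : h^-1 * flat k h = flat k.+1 h.
      by rewrite /flat; case: ifP => _; rewrite ?mulr0// exprS mulrA.
    rewrite ger0_norm ?flat_ge0// (le_lt_trans (flat_le _ _))//.
    rewrite mulrC -ltr_pdivlMr ?ltr0n ?fact_gt0//; near: h.
    by apply: dnbhs0_lt; rewrite divr_gt0// ltr0n fact_gt0.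
  apply: DeriveDef; first by apply/cvg_ex; exists 0.
  by rewrite /flat ltxx mulr0 subr0; apply/cvg_lim.
Unshelve. all: by end_near. Qed.

Lemma continuous_flat k : continuous (flat k).
Proof.
move=> x; apply: differentiable_continuous; apply/derivable1_diffP.
by have [] := is_derive_flat k x.
Qed.

End flat.

Section flat_generated.
Context {R : realType} {n : nat}.

(** A class of continuous functions that is closed under partial derivatives,
    so that all its members are smooth. *)
Inductive flat_generated : ('rV[R]_n -> R) -> Prop :=
| flat_generated_cst c : flat_generated (fun=> c)
| flat_generated_flat k c d i :
    flat_generated (fun x => flat k (c * x ord0 i + d))
| flat_generatedD u v :
    flat_generated u -> flat_generated v -> flat_generated (u + v)
| flat_generatedM u v :
    flat_generated u -> flat_generated v -> flat_generated (u * v).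

Lemma flat_generated_continuous u : flat_generated u -> continuous u.
Proof.
elim=> [c|k c d i|v w _ cv _ cw|v w _ cv _ cw].
- by move=> x; exact: cst_continuous.
- have h (x : 'rV[R]_n) : c * (y : 'rV[R]_n) ord0 i + d @[y --> x] --> c * x ord0 i + d.
    apply: (@cvgD R R _ (nbhs x) _ (fun y => c * y ord0 i) (cst d)); last exact: cvg_cst.
    by apply: (@cvgM R _ (nbhs x) _ (cst c)); [exact: cvg_cst|exact: coord_continuous].
  move=> x; apply: (@continuous_comp _ _ _ (fun x : 'rV[R]_n => c * x ord0 i + d)).
    exact: h.
  exact: continuous_flat.
- by move=> x; apply: continuousD; [exact: cv|exact: cw].
- by move=> x; apply: continuousM; [exact: cv|exact: cw].
Qed.

Lemma flat_generated_partial u i : flat_generated u ->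
  (forall x, derivable u x (delta_mx ord0 i)) /\ flat_generated (partial i u).
Proof.
elim=> [c|k c d j|v w gv [dv pv] gw [dw pw]|v w gv [dv pv] gw [dw pw]].
- split=> [x|]; first exact: derivable_cst.
  rewrite (_ : partial _ _ = fun=> 0); first exact: flat_generated_cst.
  by apply/funext => x; rewrite /partial derive_cst.
- pose G (x : 'rV[R]_n) := flat k (c * x ord0 j + d).
  have dG x : is_derive x (delta_mx ord0 i) G
      (c * (j == i)%:R * (flat k.+2 (c * x ord0 j + d) - k%:R * flat k.+1 (c * x ord0 j + d))).
    pose g s : R := flat k ((c * (j == i)%:R) *: (s : R) + (c * x ord0 j + d)).
    have h := @derive_transport R 'rV[R]_n R G g x (delta_mx ord0 i) 0 1.
    have {h}[|h1 h2] := h.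
      by move=> s; rewrite /G /g !mxE eqxx/= addr0 /GRing.scale/=; congr (flat k _); ring.
    have dg : is_derive (0 : R) (1 : R) g (c * (j == i)%:R * (flat k.+2 (c * x ord0 j + d) -
      k%:R * flat k.+1 (c * x ord0 j + d))).
      have := is_derive_flat k ((c * (j == i)%:R) *: (0 : R) + (c * x ord0 j + d)).
      rewrite scaler0 add0r => df.
      apply: is_derive_eq.
        apply: (@is_derive1_comp _ (flat k) (((c * (j == i)%:R) \*: id) + cst (c * x ord0 j +
          d))).
        by rewrite fctE/= scaler0 add0r.
      by rewrite /GRing.scale/= [X in X * _](@derive_val _ _ _ _ _ _ _ df); ring.
    by apply: DeriveDef; [apply/h1; case: dg|rewrite h2; case: dg].
  split=> [x|]; first by case: (dG x).
  rewrite (_ : partial _ _ = (fun=> c * (j == i)%:R) *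
     ((fun x => flat k.+2 (c * x ord0 j + d)) + (fun=> - k%:R) * (fun x => flat k.+1 (c * x
       ord0 j + d)))).
    apply: flat_generatedM; first exact: flat_generated_cst.
    apply: flat_generatedD; first exact: flat_generated_flat.
    apply: flat_generatedM; first exact: flat_generated_cst.
    exact: flat_generated_flat.
  by apply/funext => x; rewrite /partial (derive_val (is_derive := dG x)) !fctE; ring.
- split=> [x|]; first exact: derivableD.
  rewrite (_ : partial _ _ = partial i v + partial i w); first exact: flat_generatedD.
  by apply/funext => x; rewrite /partial deriveD.
- split=> [x|]; first exact: derivableM.
  rewrite (_ : partial _ _ = v * partial i w + w * partial i v).
    by apply: flat_generatedD; apply: flat_generatedM.
  by apply/funext => x; rewrite /partial deriveM.
Qed.

Lemma flat_generated_smooth u : flat_generated u -> smooth u.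
Proof.
move=> + k; elim: k u => [|k IH] u gu /=; first exact: flat_generated_continuous.
split=> [|i]; first exact: flat_generated_continuous.
by have [? ?] := flat_generated_partial i gu; split => //; exact: IH.
Qed.

(** A smooth function supported in the box, with values in [0, 1], that tends to
    its indicator function as m -> oo. *)
Definition box_bump (a b : 'rV[R]_n) (m : nat) (x : 'rV[R]_n) : R :=
  \prod_(i < n) (flat 0 (m.+1%:R * (x ord0 i - a ord0 i)) *
                 flat 0 (m.+1%:R * (b ord0 i - x ord0 i))).

Definition box (a b : 'rV[R]_n) : set 'rV[R]_n :=
  [set x | forall i, a ord0 i < x ord0 i < b ord0 i].

Lemma flat_generated_box_bump a b m : flat_generated (box_bump a b m).
Proof.
rewrite (_ : box_bump a b m = \prod_(i < n)
  ((fun x => flat 0 (m.+1%:R * x ord0 i + - (m.+1%:R * a ord0 i))) *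
   (fun x => flat 0 (- m.+1%:R * x ord0 i + m.+1%:R * b ord0 i)))).
  apply big_ind; first exact: flat_generated_cst.
    exact: flat_generatedM.
  by move=> i _; apply: flat_generatedM; exact: flat_generated_flat.
apply/funext => x; rewrite /box_bump fct_prodE; apply: eq_bigr => i _.
by rewrite fctE; congr (flat 0 _ * flat 0 _); ring.
Qed.

Lemma box_bump_ge0 a b m x : 0 <= box_bump a b m x.
Proof. by apply: prodr_ge0 => i _; rewrite mulr_ge0// flat_ge0. Qed.

Lemma flat0_le1 (x : R) : flat 0 x <= 1.
Proof.
rewrite /flat; case: ifPn => // x0; rewrite expr0 mul1r -expR0 ler_expR.
by rewrite oppr_le0 invr_ge0 ltW.
Qed.

Lemma box_bump_le1 a b m x : box_bump a b m x <= 1.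
Proof.
apply: prodr_ile1 => i _; rewrite mulr_ge0 ?flat_ge0//=.
by apply: mulr_ile1; rewrite ?flat_ge0 ?flat0_le1.
Qed.

Lemma box_bump_outside a b m x : ~ box a b x -> box_bump a b m x = 0.
Proof.
move=> /existsNP[i /negP]; rewrite negb_and -!leNgt => h.
rewrite /box_bump (bigD1 i)//=; apply/eqP; rewrite !mulf_eq0; apply/orP; left.
by case/orP: h => h; apply/orP; [left|right]; rewrite /flat ltNge pmulr_rle0// subr_le0 h.
Qed.

Lemma cvg_box_bump a b x : box a b x -> box_bump a b m x @[m --> \oo] --> (1 : R).
Proof.
move=> bx.
have flat1 (t : R) : 0 < t -> flat 0 (m.+1%:R * t) @[m --> \oo] --> (1 : R).
  move=> t0; rewrite (_ : (fun m => _) = (fun m => expR (- (t^-1 * m.+1%:R^-1)))).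
    rewrite (_ : nbhs (1 : R) = nbhs (expR (- (t^-1 * 0)))); last first.
      by rewrite mulr0 oppr0 expR0.
    apply: continuous_cvg; first exact: continuous_expR.
    apply: cvgN; apply: cvgM; first exact: cvg_cst.
    exact: cvg_harmonic.
  by apply/funext => m; rewrite /flat mulr_gt0// expr0 mul1r invfM mulrC.
rewrite (_ : 1 = \prod_(i < n) (1 * 1)); last by rewrite big1// => i _; rewrite mulr1.
apply: cvg_big => [|i _]; first exact: mul_continuous.
by have /andP[h1 h2] := bx i; apply: cvgM; apply: flat1; rewrite subr_gt0.
Qed.

End flat_generated.

(** * The fundamental lemma of the calculus of variations *)

Section boxes.
Context {R : realType} {n : nat}.
Implicit Types a b c x : 'rV[R]_n.

Lemma compact_closed_cube c (r : R) : compact (closed_cube c r).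
Proof.
apply: (@subclosed_compact _ _ (cube (`|c| + r))); last 2 first.
- exact: compact_cube.
- move=> y h i; rewrite -(subrK (c ord0 i) (y ord0 i)) addrC.
  by rewrite (le_trans (ler_normD _ _))// lerD// normr_coord_le.
rewrite (_ : closed_cube c r = \bigcap_(i in [set: 'I_n])
   ((fun y : 'rV[R]_n => y ord0 i) @^-1` `[c ord0 i - r, c ord0 i + r])); last first.
  by apply/seteqP; split=> y h i; have := h i; rewrite /= in_itv/= ler_distl; move=> ->.
apply: closed_bigI => i _.
apply: (@preimage_closed _ _ (fun y : 'rV[R]_n => y ord0 i)
   `[c ord0 i - r, c ord0 i + r]%classic) => [y _|]; last exact: itv_closed.
exact: coord_continuous.
Qed.

Lemma measurable_box a b : measurable (box a b).
Proof.
rewrite (_ : box a b = \bigcap_(i in [set: 'I_n])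
   ((fun y : 'rV[R]_n => y ord0 i) @^-1` `]a ord0 i, b ord0 i[)); last first.
  by apply/seteqP; split=> y h i; have := h i; rewrite /= in_itv/=; move=> ->.
apply: fin_bigcap_measurable => [|i _]; first exact: finite_finset.
have := @measurable_coord_rV R n i measurableT `]a ord0 i, b ord0 i[%classic.
by rewrite setTI; apply.
Qed.

Definition boxes : set (set 'rV[R]_n) := [set box ab.1 ab.2 | ab in [set: _ * _]].

Lemma boxI a b a' b' : box a b `&` box a' b' =
  box (\row_i Num.max (a ord0 i) (a' ord0 i)) (\row_i Num.min (b ord0 i) (b' ord0 i)).
Proof.
apply/seteqP; split=> [x [h1 h2] i|x h]; last split=> i; rewrite ?mxE.
- by rewrite gt_max lt_min; case/andP: (h1 i) => -> ->; case/andP: (h2 i) => -> ->.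
- by have := h i; rewrite !mxE gt_max lt_min => /andP[/andP[-> _] /andP[-> _]].
- by have := h i; rewrite !mxE gt_max lt_min => /andP[/andP[_ ->] /andP[_ ->]].
Qed.

Lemma setI_closed_boxes : setI_closed boxes.
Proof.
move=> A B [[a b] _ <-] [[a' b'] _ <-]; rewrite boxI.
by exists (\row_i Num.max (a ord0 i) (a' ord0 i), \row_i Num.min (b ord0 i) (b' ord0 i)).
Qed.

(** The boxes form a pi-system, so that integrals over measurable sets are
    controlled by integrals over boxes. *)
Lemma measurable_rV_boxes : @measurable _ 'rV[R]_n = <<s boxes >>.
Proof.
have sG : sigma_algebra setT <<s boxes >> by exact: smallest_sigma_algebra.
apply/seteqP; split; last first.
  apply: smallest_sub; first exact: sigma_algebra_measurable.
  by move=> _ [[a b] _ <-]; exact: measurable_box.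
apply: smallest_sub => //; rewrite -bigcup_seq => B [i _ [C mC <-]]; rewrite setTI.
have {}mC : (@RGenOpens.G R).-sigma.-measurable C.
  by rewrite -RGenOpens.measurableE.
pose H : set (set R) := [set D | <<s boxes >> ((fun x : 'rV[R]_n => x ord0 i) @^-1` D)].
suff : <<s (@RGenOpens.G R) >> `<=` H by apply.
apply: smallest_sub; first split.
- by rewrite /H/= preimage_set0; exact: sigma_algebra0.
- by move=> D HD; rewrite /H/= setTD -preimage_setC -setTD; exact: sigma_algebraCD.
- by move=> F HF; rewrite /H/= preimage_bigcup; exact: sigma_algebra_bigcup.
move=> _ [x [y ->]]; rewrite /H/=.
rewrite (_ : _ @^-1` _ = \bigcup_k box (\row_j if j == i then x else - k%:R)
   (\row_j if j == i then y else k%:R)).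
  apply: sigma_algebra_bigcup => k; apply: sub_sigma_algebra.
  by exists (\row_j (if j == i then x else - k%:R),
    \row_j (if j == i then y else k%:R)).
apply/seteqP; split=> [z /= |z [k _ /(_ i)]]; last by rewrite !mxE eqxx /= in_itv.
rewrite in_itv/= => xzy; exists (Num.bound `|z|) => // j; rewrite !mxE.
case: eqP => [->//|_]; rewrite -ltr_norml (le_lt_trans (normr_coord_le _ _))//.
exact: archi_boundP.
Qed.

End boxes.

Section fundamental_lemma.
Context {R : realType} {n : nat}.
Variable Omega : set 'rV[R]_n.
Hypothesis oO : open Omega.
Local Notation leb := (lebesgue_rV R n).

Lemma test_box_bump (a b : 'rV[R]_n) c (r : R) m : box a b `<=` closed_cube c r ->
  closed_cube c r `<=` Omega ->
  test_function Omega (box_bump a b m).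
Proof.
move=> abc cO; split; first exact: flat_generated_smooth (flat_generated_box_bump a b m).
exists (closed_cube c r); split=> //; first exact: compact_closed_cube.
by move=> x nx; apply: box_bump_outside => /abc.
Qed.

Variable g : 'rV[R]_n -> R.
Hypothesis ig : leb.-integrable Omega (EFin \o g).
Hypothesis g0 : forall phi, test_function Omega phi ->
  \int[leb]_(x in Omega) (g x * phi x) = 0.

Let mO : measurable Omega. Proof. exact: open_measurable_rV. Qed.

Let mg : measurable_fun Omega g.
Proof. by apply/measurable_EFinP; exact: measurable_int ig. Qed.

Let mbump (a b : 'rV[R]_n) m : measurable_fun Omega (box_bump a b m).
Proof.
apply: continuous_measurable_rV => //.
exact: flat_generated_continuous (flat_generated_box_bump a b m).
Qed.

(** Dominated convergence: g times a bump function converges to g times the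
    indicator function of the box. *)
Lemma integral_box_eq0 (a b : 'rV[R]_n) c (r : R) : box a b `<=` closed_cube c r ->
  closed_cube c r `<=` Omega ->
  (\int[leb]_(x in box a b) (g x)%:E = 0)%E.
Proof.
move=> abc cO; have mb := measurable_box a b.
pose F m x := (g x * box_bump a b m x)%:E.
have mF m : measurable_fun Omega (F m).
  by apply/measurable_EFinP; exact: measurable_funM.
pose G := (EFin \o g) \_ (box a b).
have mG : measurable_fun Omega G.
  apply/(measurable_restrict _ mb mO).
  by apply: measurable_funS (measurable_int _ ig) => //; exact: subIsetl.
have cF : {ae leb, forall x, Omega x -> F ^~ x @ \oo --> G x}.
  apply: aeW => x _; rewrite /G patchE; case: ifPn => [|]; rewrite ?notin_setE ?inE => bx.
    have -> : (EFin \o g) x = (g x * 1)%:E by rewrite mulr1.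
    apply: cvg_EFin; first exact: nearW.
    by apply: cvgM; [exact: cvg_cst|exact: cvg_box_bump].
  rewrite (_ : F ^~ x = cst 0%E); first exact: cvg_cst.
  by apply/funext => m; rewrite /F box_bump_outside// mulr0.
have FG : {ae leb, forall x m, Omega x -> (`|F m x| <= `|(g x)%:E|)%E}.
  apply: aeW => x m _; rewrite /F lee_fin normrM ler_piMr//.
  by rewrite ger0_norm ?box_bump_ge0// box_bump_le1.
have iag := integrable_abse ig.
have [_ _] := dominated_convergence mO mF mG cF iag FG.
have -> : (fun m => \int[leb]_(x in Omega) F m x)%E = cst 0%E.
  apply/funext => m; have iF : leb.-integrable Omega (F m).
    apply: le_integrable ig => // x _; rewrite /F lee_fin normrM ler_piMr//.
    by rewrite ger0_norm ?box_bump_ge0// box_bump_le1.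
  rewrite -(fineK (integrable_fin_num mO iF)).
  by congr EFin; exact: g0 (test_box_bump m abc cO).
move=> h; have := cvg_unique _ h (cvg_cst 0%E).
rewrite /G -integral_mkcondr setIidr; first exact.
by move=> x /abc /cO.
Qed.

(** The integral of g vanishes on the boxes in a cube, hence on all measurable
    subsets of this cube by Dynkin's theorem; countably many cubes cover Omega. *)
Lemma ae_zero_of_test : {ae leb, forall x, Omega x -> g x = 0}.
Proof.
have open_cube_ae0 c (r : R) : closed_cube c r `<=` Omega -> {ae leb, forall x,
  open_cube c r x -> g x = 0}.
  move=> cO.
  have oE : open_cube c r = box (\row_i (c ord0 i - r)) (\row_i (c ord0 i + r)).
    by apply/seteqP; split=> y h i; have := h i; rewrite ?mxE ltr_distl.
  have oc : open_cube c r `<=` closed_cube c r by move=> y h i; exact: ltW.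
  have mo := measurable_open_cube c r.
  have iB : leb.-integrable (open_cube c r) (EFin \o g).
    by apply: integrableS ig => // x /oc /cO.
  have key A : measurable A -> (\int[leb]_(x in A `&` open_cube c r) (g x)%:E = 0)%E.
    rewrite {1}measurable_rV_boxes; move: A.
    apply: (@dynkin_induction _ _ boxes
      (fun A => \int[leb]_(x in A `&` open_cube c r) (g x)%:E = 0)%E).
    - exact: measurable_rV_boxes.
    - exact: setI_closed_boxes.
    - rewrite setTI oE; apply: (@integral_box_eq0 _ _ c r) => //.
      by rewrite -oE.
    - move=> _ [[a b] _ <-]; rewrite /= oE boxI; apply: (@integral_box_eq0 _ _ c r) => //.
      by rewrite -boxI -oE => x [_ /oc].
    - move=> S mS PS.
      have := @integral_setU _ _ _ leb (S `&` open_cube c r) (~` S `&` open_cube c r) (EFin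
        \o g).
      rewrite -setIUl setUv setTI => /=.
      rewrite PS add0e => <- //.
      + rewrite oE; apply: (@integral_box_eq0 _ _ c r) => //.
        by rewrite -oE.
      + exact: measurableI.
      + by apply: measurableI => //; exact: measurableC.
      + exact: measurable_int iB.
      + by apply/disj_setPS => x [[? _] []].
    - move=> F mF tF PF; rewrite setI_bigcupl integral_bigcup.
      + by rewrite eseries0.
      + by apply: trivIset_setIr.
      + by move=> k; exact: measurableI.
      + apply: integrableS iB => //; first by apply: bigcupT_measurable => k;
        exact: measurableI.
        by move=> x [k _ []].
  have := @integral_ae_eq _ _ _ leb _ mo (cst 0%E) (EFin \o g) iB (measurable_cst _).
  move=> h; have {h} : ae_eq leb (open_cube c r) (EFin \o g) (cst 0%E).
    apply: h => E EO mE; rewrite integral0 -[in LHS](setIidl EO); exact: key.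
  by apply: filterS => x h ox; have := h ox; move=> /= [].
pose P k x := if (unpickle k : option ('rV[rat]_n * nat)) is Some ck then
  closed_cube (rat_vec ck.1) ck.2.+1%:R^-1 `<=` Omega ->
  open_cube (rat_vec ck.1) ck.2.+1%:R^-1 x -> g x = 0 else True.
have : {ae leb, forall x k, P k x}.
  apply: ae_foralln => k; rewrite /P; case: (unpickle k) => [ck|]; last exact: aeW.
  have [/open_cube_ae0 h|h] := pselect (closed_cube (rat_vec ck.1) (ck.2.+1%:R^-1 : R) `<=`
    Omega).
    by apply: filterS h => x hx _.
  by apply: aeW => x /h.
apply: filterS => x Px; rewrite {1}(open_bigcup_open_cube oO) => -[ck h xck].
by have := Px (pickle ck); rewrite /P pickleK; apply.
Qed.

End fundamental_lemma.

(** * Weak gradients and the space H_0^1 *)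

Section sobolev_theory.
Context {R : realType} {n : nat}.
Variable Omega : set 'rV[R]_n.
Hypothesis oO : open Omega.
Hypothesis bO : bounded_set Omega.
Local Notation leb := (lebesgue_rV R n).
Local Notation test := (test_function Omega).
Implicit Types (u w : 'rV[R]_n -> R) (phi : 'rV[R]_n -> R).

Lemma measurable_Omega : measurable Omega. Proof. exact: open_measurable_rV. Qed.
Let mO := measurable_Omega.

Lemma lebesgue_Omega : (leb Omega < +oo)%E.
Proof.
have [r _ Or] := bounded_cube bO.
apply: le_lt_trans (lebesgue_rV_cube n r).
by apply: le_measure; rewrite ?inE//; exact: measurable_cube.
Qed.

Definition integrable_on (u : 'rV[R]_n -> R) := leb.-integrable Omega (EFin \o u).

Lemma integrable_onD u w : integrable_on u -> integrable_on w -> integrable_on (u \+ w).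
Proof. by move=> iu iw; exact: (integrableD mO iu iw). Qed.

Lemma integrable_onZ (t : R) u : integrable_on u -> integrable_on (fun x => t * u x).
Proof. by move=> iu; exact: (integrableZl mO t iu). Qed.

Lemma integrable_onB u w : integrable_on u -> integrable_on w -> integrable_on (u \- w).
Proof. by move=> iu iw; exact: (integrableB mO iu iw). Qed.

Lemma integrable_on_le u w : measurable_fun Omega u -> integrable_on w ->
  (forall x, Omega x -> `|u x| <= w x) -> integrable_on u.
Proof.
move=> mu iw uw; apply: le_integrable iw => //; first exact/measurable_EFinP.
by move=> x /uw h /=; rewrite lee_fin (le_trans h)// ler_norm.
Qed.

Lemma integrable_on_measurable u : integrable_on u -> measurable_fun Omega u.
Proof. by move=> iu; apply/measurable_EFinP; exact: measurable_int iu. Qed.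

Lemma integrable_on_sum (I : finType) (u : I -> 'rV[R]_n -> R) :
  (forall i, integrable_on (u i)) -> integrable_on (fun x => \sum_i u i x).
Proof.
move=> iu; apply: (@eq_integrable _ _ _ _ _ mO (fun x => \sum_(i <- index_enum I) (u i
  x)%:E)%E).
  by move=> x _; rewrite sumEFin.
by apply: integrable_sum => // i _; exact: iu.
Qed.

Lemma integrable_on_bounded u (C : R) : measurable_fun Omega u ->
  (forall x, Omega x -> `|u x| <= C) -> integrable_on u.
Proof.
move=> mu uC; apply: measurable_bounded_integrable => //; first exact: lebesgue_Omega.
exists C; split=> [|M CM x Ox]; first exact: num_real.
by rewrite /= (le_trans (uC x Ox))// ltW.
Qed.

Lemma L2_mul_integrable u w : L2 Omega u -> L2 Omega w -> integrable_on (fun x => u x * w x).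
Proof.
move=> [mu iu] [mw iw]; apply: (@integrable_on_le _ ((fun x => u x ^+ 2) \+ (fun x => w x ^+
  2))).
- exact: measurable_funM.
- exact: integrable_onD.
- move=> x _ /=; have : 0 <= `|u x| by []. have : 0 <= `|w x| by [].
  rewrite normrM -(real_normK (num_real (u x))) -(real_normK (num_real (w x))); nra.
Qed.

Lemma L2_bounded u (C : R) : measurable_fun Omega u ->
  (forall x, Omega x -> `|u x| <= C) -> L2 Omega u.
Proof.
move=> mu uC; split=> //; apply: (@integrable_on_bounded _ (C ^+ 2)).
  exact: measurable_funX.
move=> x Ox; rewrite normrX lerXn2r ?nnegrE//; last exact: uC.
exact: le_trans (uC x Ox).
Qed.

Lemma L2_integrable u : L2 Omega u -> integrable_on u.
Proof.
move=> Lu; have L1 : L2 Omega (fun=> 1).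
  by apply: (@L2_bounded _ 1) => // x _; rewrite normr1.
by have := L2_mul_integrable Lu L1; under eq_fun do rewrite mulr1.
Qed.

Lemma L2_comb (a b : R) u w : L2 Omega u -> L2 Omega w ->
  L2 Omega (fun x => a * u x + b * w x).
Proof.
move=> Lu Lw; have [mu iu] := Lu; have [mw iw] := Lw; split.
  by apply: measurable_funD; apply: measurable_funM.
have h := integrable_onD (integrable_onD (integrable_onZ (a ^+ 2) iu) (integrable_onZ (b ^+
  2) iw)) (integrable_onZ (2 * a * b) (L2_mul_integrable Lu Lw)).
apply: (@eq_integrable _ _ _ _ _ mO _ _ _ h) => x _ /=; congr EFin; ring.
Qed.

Lemma RintD u w : integrable_on u -> integrable_on w ->
  \int[leb]_(x in Omega) (u x + w x) =
  \int[leb]_(x in Omega) u x + \int[leb]_(x in Omega) w x.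
Proof. by move=> iu iw; rewrite -RintegralD. Qed.

Lemma RintZ (t : R) u : integrable_on u ->
  \int[leb]_(x in Omega) (t * u x) = t * \int[leb]_(x in Omega) u x.
Proof. by move=> iu; rewrite RintegralZl. Qed.

Lemma Rint_le u w : integrable_on u -> integrable_on w -> (forall x, Omega x -> u x <= w x) ->
  \int[leb]_(x in Omega) u x <= \int[leb]_(x in Omega) w x.
Proof. by move=> iu iw uw; apply: le_Rintegral. Qed.

Lemma Rint_ae u w : measurable_fun Omega u -> measurable_fun Omega w ->
  {ae leb, forall x, Omega x -> u x = w x} ->
  \int[leb]_(x in Omega) u x = \int[leb]_(x in Omega) w x.
Proof.
move=> mu mw uw; rewrite /Rintegral; congr fine; apply: ae_eq_integral => //.
- exact/measurable_EFinP.
- exact/measurable_EFinP.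
- by apply: filterS uw => x h Ox /=; rewrite h.
Qed.

Lemma smooth_continuous u : smooth u -> continuous u.
Proof. by move=> /(_ 0%N). Qed.

Lemma smooth_derivable u i x : smooth u -> derivable u x (delta_mx ord0 i).
Proof. by move=> /(_ 1%N)[_ /(_ i)[]]. Qed.

Lemma smooth_partial u i : smooth u -> smooth (partial i u).
Proof. by move=> su k; have [_ /(_ i)[]] := su k.+1. Qed.

Lemma smoothZ (t : R) u : smooth u -> smooth (fun x => t * u x).
Proof.
move=> + k; elim: k u => [|k IH] u su.
  move=> x; apply: continuousM; first exact: cst_continuous.
  exact: smooth_continuous.
have ct : continuous (fun x => t * u x).
  move=> x; apply: continuousM; first exact: cst_continuous.
  exact: smooth_continuous.
split=> // i; have du x := @smooth_derivable u i x su; split.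
  by move=> x; apply: (@derivableZ _ _ _ u).
rewrite (_ : partial _ _ = fun x => t * partial i u x).
  by apply: IH; exact: smooth_partial.
by apply/funext => x; rewrite /partial (@deriveZ _ _ _ u).
Qed.

Lemma testZ (t : R) phi : test phi -> test (fun x => t * phi x).
Proof.
move=> [sphi [K [cK KO phi0]]]; split; first exact: smoothZ.
by exists K; split => // x /phi0 ->; rewrite mulr0.
Qed.

Lemma hausdorff_rV : hausdorff_space 'rV[R]_n.
Proof. exact: norm_hausdorff. Qed.

Lemma test_bounds phi : test phi ->
  exists2 C : R, 0 < C & (forall x, `|phi x| <= C) /\ (forall i x, `|partial i phi x| <= C).
Proof.
move=> [sphi [K [cK KO phi0]]].
have [C C0 phiC] := compactly_supported_bounded cK (smooth_continuous sphi) phi0.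
have /choice[D hD] : forall i, exists C : R, forall x, `|partial i phi x| <= C.
  move=> i; have clK := compact_closed hausdorff_rV cK.
  have [D _ h] := compactly_supported_bounded cK
    (smooth_continuous (smooth_partial i sphi)) (partial_outside i clK phi0).
  by exists D.
exists (C + \sum_i `|D i|); first by rewrite ltr_pwDl// sumr_ge0.
split=> [x|i x]; first by rewrite (le_trans (phiC x))// lerDl sumr_ge0.
rewrite (le_trans (hD i x))// (le_trans (ler_norm _))// (bigD1 i)//=.
by rewrite addrCA lerDl addr_ge0 ?(ltW C0)// sumr_ge0.
Qed.

Lemma test_measurable phi : test phi -> measurable_fun Omega phi.
Proof. by move=> [sphi _]; apply: continuous_measurable_rV => //; exact: smooth_continuous. Qed.

Lemma test_partial_measurable phi i : test phi -> measurable_fun Omega (partial i phi).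
Proof.
move=> [sphi _]; apply: continuous_measurable_rV => //.
exact/smooth_continuous/smooth_partial.
Qed.

Lemma test_L2 phi : test phi -> L2 Omega phi.
Proof.
move=> tphi; have [C C0 [h _]] := test_bounds tphi.
by apply: (@L2_bounded _ C) => //; exact: test_measurable.
Qed.

Lemma test_partial_L2 phi i : test phi -> L2 Omega (partial i phi).
Proof.
move=> tphi; have [C C0 [_ h]] := test_bounds tphi.
by apply: (@L2_bounded _ C) => //; exact: test_partial_measurable.
Qed.

(** The support K is inside Omega, so the integral over Omega is one over R^n. *)
Lemma Rint_partial0 (psi : 'rV[R]_n -> R) (K : set 'rV[R]_n) i : compact K -> K `<=` Omega ->
  continuous psi -> (forall x, derivable psi x (delta_mx ord0 i)) ->
  continuous (partial i psi) -> (forall x, ~ K x -> psi x = 0) ->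
  \int[leb]_(x in Omega) partial i psi x = 0.
Proof.
move=> cK KO cpsi dpsi cdpsi psi0.
have [r r0 Kr] := bounded_cube (compact_bounded cK).
have psi0r x : ~ cube r x -> psi x = 0 by move=> nx; apply: psi0 => /Kr.
have := integral_partial0 r0 cpsi dpsi cdpsi psi0r.
rewrite /Rintegral => h; rewrite integral_mkcond.
rewrite (_ : _ \_ _ = fun x => (partial i psi x)%:E) ?h//.
apply/funext => x; rewrite patchE; case: ifPn => //; rewrite notin_setE => Ox.
by rewrite (partial_outside i (compact_closed hausdorff_rV cK) psi0)// => /KO.
Qed.

Lemma continuous_rVM u w : continuous u -> continuous w -> continuous (fun x => u x * w x).
Proof. by move=> cu cw x; apply: continuousM; [exact: cu|exact: cw]. Qed.

Lemma continuous_rVD u w : continuous u -> continuous w -> continuous (fun x => u x + w x).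
Proof. by move=> cu cw x; apply: continuousD; [exact: cu|exact: cw]. Qed.

Lemma partialM u w i x : derivable u x (delta_mx ord0 i) -> derivable w x (delta_mx ord0 i) ->
  partial i (fun x => u x * w x) x = u x * partial i w x + w x * partial i u x.
Proof.
move=> du dw; rewrite /partial.
have -> : (fun y => u y * w y) = u * w by [].
by rewrite deriveM. Qed.

(** Apply [Rint_partial0] to the product phi psi. *)
Lemma test_ibp phi psi i : test phi -> test psi ->
  \int[leb]_(x in Omega) (phi x * partial i psi x) =
  - \int[leb]_(x in Omega) (partial i phi x * psi x).
Proof.
move=> tphi tpsi; apply/eqP; rewrite -addr_eq0 -RintD; last 2 first.
  by apply: L2_mul_integrable; [exact: test_L2|exact: test_partial_L2].
  by apply: L2_mul_integrable; [exact: test_partial_L2|exact: test_L2].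
have [sphi [K [cK KO phi0]]] := tphi; have [spsi _] := tpsi.
have dphi x := @smooth_derivable phi i x sphi; have dpsi x := @smooth_derivable psi i x spsi.
have E : partial i (fun x => phi x * psi x) =
    fun x => phi x * partial i psi x + partial i phi x * psi x.
  by apply/funext => x; rewrite partialM// [psi x * _]mulrC.
have cphi := smooth_continuous sphi; have cpsi := smooth_continuous spsi.
have cdphi := smooth_continuous (smooth_partial i sphi).
have cdpsi := smooth_continuous (smooth_partial i spsi).
have h : \int[leb]_(x in Omega) partial i (fun x => phi x * psi x) x = 0.
  apply: (Rint_partial0 cK KO).
  - exact: continuous_rVM.
  - by move=> x; apply: (@derivableM _ _ phi psi).
  - by rewrite E; apply: continuous_rVD; apply: continuous_rVM.
  - by move=> x /phi0 ->; rewrite mul0r.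
by move: h; rewrite E => ->.
Qed.

Lemma test_weak_grad phi : test phi -> is_weak_grad Omega phi (fun i => partial i phi).
Proof. by move=> tphi i; split; [exact: test_partial_L2|move=> psi tpsi; exact: test_ibp]. Qed.

Lemma test_H1 phi : test phi -> H1 Omega phi.
Proof.
by move=> tphi; split; [exact: test_L2|exists (fun i => partial i phi); exact: test_weak_grad].
Qed.

Lemma weak_gradP u : H1 Omega u -> is_weak_grad Omega u (weak_grad Omega u).
Proof. by move=> [_ h]; have := xgetPex (fun _ _ => 0) h. Qed.

Lemma weak_grad_unique u g g' i : is_weak_grad Omega u g -> is_weak_grad Omega u g' ->
  {ae leb, forall x, Omega x -> g i x = g' i x}.
Proof.
move=> /(_ i)[Lg hg] /(_ i)[Lg' hg'].
have Ld := L2_comb 1 (-1) Lg Lg'.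
have := @ae_zero_of_test _ _ _ oO _ (L2_integrable Ld).
have h0 phi : test phi ->
    \int[leb]_(x in Omega) ((1 * g i x + -1 * g' i x) * phi x) = 0.
  move=> tphi; have Lphi := test_L2 tphi.
  transitivity (\int[leb]_(x in Omega) (g i x * phi x + -1 * (g' i x * phi x))).
    by apply: eq_Rintegral => x _; ring.
  rewrite RintD; last 2 first.
    exact: L2_mul_integrable.
    by apply: integrable_onZ; exact: L2_mul_integrable.
  rewrite RintZ; last exact: L2_mul_integrable.
  by have := hg _ tphi; rewrite hg'// => /oppr_inj ->; ring.
move=> /(_ h0); apply: filterS => x h Ox; have := h Ox.
by rewrite mul1r mulN1r => /eqP; rewrite subr_eq0 => /eqP.
Qed.

Lemma weak_grad_comb (a b : R) u w g g' : L2 Omega u -> L2 Omega w ->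
  is_weak_grad Omega u g -> is_weak_grad Omega w g' ->
  is_weak_grad Omega (fun x => a * u x + b * w x) (fun i x => a * g i x + b * g' i x).
Proof.
move=> Lu Lw hg hg' i; have [Lg ug] := hg i; have [Lg' wg'] := hg' i.
split=> [|phi tphi]; first exact: L2_comb.
have Lphi := test_L2 tphi; have Ldphi := test_partial_L2 i tphi.
transitivity (\int[leb]_(x in Omega) (a * (u x * partial i phi x) + b * (w x * partial i phi
  x))).
  by apply: eq_Rintegral => x _; ring.
have -> : \int[leb]_(x in Omega) ((a * g i x + b * g' i x) * phi x) =
    \int[leb]_(x in Omega) (a * (g i x * phi x) + b * (g' i x * phi x)).
  by apply: eq_Rintegral => x _; ring.
have := (L2_mul_integrable Lu Ldphi, L2_mul_integrable Lw Ldphi, L2_mul_integrable Lg Lphi,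
  L2_mul_integrable Lg' Lphi).
move=> [[[i1 i2] i3] i4]; rewrite !RintD ?RintZ//; try exact: integrable_onZ.
by rewrite ug// wg'//; ring.
Qed.

Lemma weak_grad_sq_int u g : is_weak_grad Omega u g -> integrable_on (fun x => \sum_i g i x
  ^+ 2).
Proof. by move=> hg; apply: integrable_on_sum => i; have [[]] := hg i. Qed.

(** By uniqueness the norm can be computed from any weak gradient. *)
Lemma grad_dotE u g : is_weak_grad Omega u g ->
  grad_dot Omega u u = \int[leb]_(x in Omega) (\sum_i g i x ^+ 2).
Proof.
move=> hg; have hw : is_weak_grad Omega u (weak_grad Omega u).
  by have := @xgetPex _ (fun _ _ => 0) [set g | is_weak_grad Omega u g] (ex_intro _ g hg).
rewrite /grad_dot; under eq_Rintegral do under eq_bigr do rewrite -expr2.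
apply: Rint_ae.
- exact: integrable_on_measurable (weak_grad_sq_int hw).
- exact: integrable_on_measurable (weak_grad_sq_int hg).
- have : {ae leb, forall x, forall i, Omega x -> weak_grad Omega u i x = g i x}.
    by apply: filter_forall => i; exact: weak_grad_unique.
  by apply: filterS => x h Ox; apply: eq_bigr => i _; rewrite h.
Qed.

Lemma grad_dot_ge0 u : 0 <= grad_dot Omega u u.
Proof.
apply: Rintegral_ge0 => x _; apply: sumr_ge0 => i _.
by rewrite -expr2 sqr_ge0.
Qed.

Lemma grad_dot_testZ (t : R) phi : test phi ->
  grad_dot Omega (fun x => t * phi x) (fun x => t * phi x) =
  t ^+ 2 * grad_dot Omega phi phi.
Proof.
move=> tphi; have wphi := test_weak_grad tphi; have Lphi := test_L2 tphi.
have wt : is_weak_grad Omega (fun x => t * phi x) (fun i x => t * partial i phi x).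
  have := weak_grad_comb t 0 Lphi Lphi wphi wphi.
  rewrite (_ : (fun x => t * phi x + 0 * phi x) = (fun x => t * phi x)); last first.
    by apply/funext => x; rewrite mul0r addr0.
  congr is_weak_grad; apply/funext => i; apply/funext => x.
  by rewrite mul0r addr0.
rewrite (grad_dotE wt) (grad_dotE wphi) -RintZ; last exact: weak_grad_sq_int wphi.
apply: eq_Rintegral => x _; rewrite mulr_sumr.
by apply: eq_bigr => i _; rewrite exprMn.
Qed.

(** Young's inequality 2 |a b| <= eta a^2 + b^2 / eta, componentwise.  As eta -> 0
    it transfers norms of v to its approximations. *)
Lemma grad_dot_sub_le (eta : R) u w : 0 < eta -> H1 Omega u -> H1 Omega w ->
  grad_dot Omega (u \- w) (u \- w) <=
  (1 + eta) * grad_dot Omega u u + (1 + eta^-1) * grad_dot Omega w w.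
Proof.
move=> eta0 Hu Hw; have [Lu _] := Hu; have [Lw _] := Hw.
have gu := weak_gradP Hu; have gw := weak_gradP Hw.
set g := weak_grad Omega u in gu; set g' := weak_grad Omega w in gw.
have gd : is_weak_grad Omega (u \- w) (fun i x => 1 * g i x + -1 * g' i x).
  rewrite (_ : u \- w = (fun x => 1 * u x + -1 * w x)); first exact: weak_grad_comb.
  by apply/funext => x; rewrite mul1r mulN1r.
rewrite (grad_dotE gd) (grad_dotE gu) (grad_dotE gw).
have i1 := weak_grad_sq_int gu; have i2 := weak_grad_sq_int gw.
have i3 := weak_grad_sq_int gd.
rewrite -!RintZ// -RintD; [|exact: integrable_onZ|exact: integrable_onZ].
apply: Rint_le => //; first by apply: integrable_onD; apply: integrable_onZ.
move=> x _; rewrite !mulr_sumr -big_split/=; apply: ler_sum => i _.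
set a := g i x; set b := g' i x.
have -> : (1 + eta) * a ^+ 2 + (1 + eta^-1) * b ^+ 2 =
   (1 * a + -1 * b) ^+ 2 + eta^-1 * (eta * a + b) ^+ 2.
  by field; exact: lt0r_neq0.
by rewrite lerDl mulr_ge0 ?sqr_ge0// invr_ge0 ltW.
Qed.

Lemma Rint_sqrB_le u w : L2 Omega u -> L2 Omega w ->
  \int[leb]_(x in Omega) (u x - w x) ^+ 2 <=
  2 * \int[leb]_(x in Omega) u x ^+ 2 + 2 * \int[leb]_(x in Omega) w x ^+ 2.
Proof.
move=> Lu Lw; have [_ i1] := Lu; have [_ i2] := Lw.
have [_ i3] := L2_comb 1 (-1) Lu Lw.
have {}i3 : integrable_on (fun x => (u x - w x) ^+ 2).
  by move: i3; under eq_fun do rewrite mul1r mulN1r.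
rewrite -!RintZ// -RintD; [|exact: integrable_onZ|exact: integrable_onZ].
apply: Rint_le => //; first by apply: integrable_onD; apply: integrable_onZ.
move=> x _; have := sqr_ge0 (u x + w x); nra.
Qed.

Lemma H1_sub u w : H1 Omega u -> H1 Omega w -> H1 Omega (u \- w).
Proof.
move=> Hu Hw; have [Lu _] := Hu; have [Lw _] := Hw.
rewrite (_ : u \- w = (fun x => 1 * u x + -1 * w x)); last first.
  by apply/funext => x; rewrite mul1r mulN1r.
split; first exact: L2_comb.
eexists; exact: (weak_grad_comb 1 (-1) Lu Lw (weak_gradP Hu) (weak_gradP Hw)).
Qed.

Lemma H1_norm_lt u e : 0 < e -> H1_norm Omega u < e ->
  \int[leb]_(x in Omega) (u x ^+ 2) < e ^+ 2 /\ grad_dot Omega u u < e ^+ 2.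
Proof.
move=> e0 h; have g0 := grad_dot_ge0 u.
have i0 : 0 <= \int[leb]_(x in Omega) (u x ^+ 2).
  by apply: Rintegral_ge0 => x _; exact: sqr_ge0.
have : \int[leb]_(x in Omega) (u x ^+ 2) + grad_dot Omega u u < e ^+ 2.
  rewrite -[ltLHS]sqr_sqrtr ?addr_ge0//.
  by rewrite ltr_pXn2r ?nnegrE ?sqrtr_ge0 ?(ltW e0).
by move=> h'; split; lra.
Qed.

Lemma test_H10 phi : test phi -> H10 Omega phi.
Proof.
move=> tphi; split; first exact: test_H1.
move=> e e0; exists phi => //; rewrite /H1_norm.
have z u : H1 Omega u -> (forall x, u x = 0) -> H1_norm Omega u = 0.
  move=> Hu u0; rewrite /H1_norm.
  have wz : is_weak_grad Omega u (fun i x => 0 * weak_grad Omega u i x + 0 * weak_grad Omega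
    u i x).
    rewrite {1}(_ : u = (fun x => 0 * u x + 0 * u x)).
      by case: (Hu) => Lu _; apply: weak_grad_comb => //; exact: weak_gradP.
    by apply/funext => x; rewrite u0; ring.
  rewrite (grad_dotE wz).
  have -> : \int[leb]_(x in Omega) (u x ^+ 2) = 0.
    rewrite (_ : (fun x => _) = cst 0); first by rewrite /Rintegral integral0.
    by apply/funext => x; rewrite u0 expr0n.
  rewrite (_ : (fun x => _) = cst 0); first by rewrite /Rintegral integral0 addr0 sqrtr0.
  by apply/funext => x; rewrite big1// => i _; rewrite !mul0r addr0 expr0n.
have := z (phi \- phi) (H1_sub (test_H1 tphi) (test_H1 tphi)).
by rewrite /H1_norm => -> // x; rewrite /= subrr.
Qed.

(** Only an upper bound of the norm of phi is retained: it is the one under which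
    energies are upper semicontinuous. *)
Lemma H10_approx v d : H10 Omega v -> 0 < d ->
  exists phi, [/\ test phi, \int[leb]_(x in Omega) ((v x - phi x) ^+ 2) < d &
    grad_dot Omega phi phi < grad_dot Omega v v + d].
Proof.
move=> [Hv hv] d0; have Ev := grad_dot_ge0 v.
(* The error is split into d / 2 from eta ||v||^2 and d / 2 from v - phi. *)
pose eta := d / (2 * (grad_dot Omega v v + 1)).
have eta0 : 0 < eta by rewrite divr_gt0// mulr_gt0// ltr_wpDl.
pose c := 1 + eta^-1; have c1 : 1 <= c by rewrite lerDl invr_ge0 ltW.
pose e := Num.sqrt (d / (2 * c)).
have dc0 : 0 < d / (2 * c) by rewrite divr_gt0// mulr_gt0// (lt_le_trans _ c1).
have e0 : 0 < e by rewrite sqrtr_gt0.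
have e2 : e ^+ 2 = d / (2 * c) by rewrite sqr_sqrtr// ltW.
have [phi tphi /(H1_norm_lt e0)[h1 h2]] := hv e e0.
have c0 : 0 < c by exact: lt_le_trans c1.
exists phi; split=> //.
  apply: (lt_le_trans h1); rewrite e2 ler_pdivrMr ?mulr_gt0//.
  by rewrite ler_peMr ?(ltW d0)// (le_trans c1)// ler_peMl ?(ltW c0)// ler1n.
have Hd : H1 Omega (v \- phi) by apply: H1_sub => //; exact: test_H1.
have := grad_dot_sub_le eta0 Hv Hd.
have -> : v \- (v \- phi) = phi by apply/funext => x /=; ring.
move=> /le_lt_trans; apply; rewrite -/c mulrDl mul1r -addrA ltrD2l.
have -> : d = d / 2 + d / 2 by field.
apply: ler_ltD.
  rewrite /eta mulrAC ler_pdivrMr ?mulr_gt0 ?ltr_wpDl//.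
  by rewrite mulrA divfK ?pnatr_eq0// ler_pM2l// lerDl.
rewrite -ltr_pdivlMl//; apply: (lt_le_trans h2); rewrite e2 le_eqVlt; apply/orP; left.
by apply/eqP; field; exact: lt0r_neq0.
Qed.

Lemma is_derive_coord i (x : 'rV[R]_n) :
  is_derive x (delta_mx ord0 i) (fun y : 'rV[R]_n => y ord0 i) (1 : R).
Proof.
have [|h1 h2] := @derive_transport R 'rV[R]_n R (fun y => y ord0 i) id x
  (delta_mx ord0 i) (x ord0 i) 1.
  by move=> h; rewrite !mxE !eqxx.
by apply: DeriveDef; [apply/h1; exact: derivable_id|rewrite h2 derive_id].
Qed.

(** The integral of the i-th partial derivative of x_i phi^2 vanishes, so the
    integral of phi^2 is minus that of 2 x_i phi (partial_i phi), and |x_i| <= r. *)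
Lemma poincare phi (i : 'I_n) (r : R) : Omega `<=` cube r -> test phi ->
  \int[leb]_(x in Omega) (phi x ^+ 2) <= 4 * r ^+ 2 * grad_dot Omega phi phi.
Proof.
move=> Or tphi; have [sphi [K [cK KO phi0]]] := tphi.
have wphi := test_weak_grad tphi.
have Lphi := test_L2 tphi; have Ldphi := test_partial_L2 i tphi.
rewrite (grad_dotE wphi).
pose X (x : 'rV[R]_n) := x ord0 i.
have dX x : derivable X x (delta_mx ord0 i) by case: (is_derive_coord i x).
have cX : continuous X by exact: coord_continuous.
have pX x : partial i X x = 1 by case: (is_derive_coord i x).
have dphi x := @smooth_derivable phi i x sphi.
have cphi := smooth_continuous sphi.
have cdphi := smooth_continuous (smooth_partial i sphi).
pose q x := phi x * phi x; pose psi x := X x * q x.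
pose psi0 x := X x * phi x * partial i phi x.
have dq x : derivable q x (delta_mx ord0 i) by apply: (@derivableM _ _ phi phi).
have pq x : partial i q x = 2 * phi x * partial i phi x by rewrite partialM//; ring.
have ppsi : partial i psi = fun x => phi x ^+ 2 + 2 * X x * phi x * partial i phi x.
  by apply/funext => x; rewrite partialM// pX pq /q; ring.
have bX x : Omega x -> `|X x| <= r by move=> /Or/(_ i).
have mX : measurable_fun Omega X by exact: continuous_measurable_rV.
have LX : L2 Omega (fun x => X x * phi x).
  have [C C0 [h _]] := test_bounds tphi.
  apply: (@L2_bounded _ (r * C)); first exact: measurable_funM mX (test_measurable tphi).
  by move=> x Ox; rewrite normrM; apply: ler_pM => //; exact: bX.
have i1 : integrable_on (fun x => phi x ^+ 2) by case: Lphi.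
have i2 : integrable_on (fun x => 2 * ((X x * phi x) * partial i phi x)).
  by apply: integrable_onZ; exact: L2_mul_integrable.
have i3 : integrable_on (fun x => partial i phi x ^+ 2) by case: Ldphi.
have i4 := weak_grad_sq_int wphi.
have : \int[leb]_(x in Omega) partial i psi x = 0.
  apply: (Rint_partial0 cK KO).
  - by apply: continuous_rVM => //; exact: continuous_rVM.
  - by move=> x; apply: (@derivableM _ _ X q).
  - rewrite ppsi.
    have -> : (fun x => phi x ^+ 2 + 2 * X x * phi x * partial i phi x) =
        (fun x => q x + 2 * psi0 x).
      by apply/funext => x; rewrite /q /psi0; ring.
    have cq : continuous q by exact: continuous_rVM.
    have cX' : continuous (fun x => X x * phi x) by exact: continuous_rVM.
    have cpsi0 : continuous psi0 by exact: continuous_rVM.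
    apply: continuous_rVD => //; apply: continuous_rVM => //.
    exact: cst_continuous.
  - by move=> x /phi0; rewrite /psi /q => ->; rewrite !mulr0.
rewrite ppsi.
have -> : \int[leb]_(x in Omega) (phi x ^+ 2 + 2 * X x * phi x * partial i phi x) =
    \int[leb]_(x in Omega) (phi x ^+ 2 + 2 * ((X x * phi x) * partial i phi x)).
  by apply: eq_Rintegral => x _; ring.
rewrite RintD//.
have : - (\int[leb]_(x in Omega) (2 * ((X x * phi x) * partial i phi x))) <=
    2^-1 * \int[leb]_(x in Omega) (phi x ^+ 2) +
    2 * r ^+ 2 * \int[leb]_(x in Omega) (\sum_i partial i phi x ^+ 2).
  rewrite -mulN1r -!RintZ// -RintD; [|exact: integrable_onZ|exact: integrable_onZ].
  apply: Rint_le; [exact: integrable_onZ|by apply: integrable_onD; apply: integrable_onZ|].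
  move=> x Ox; have := bX x Ox; rewrite ler_norml => /andP[x1 x2].
  have : partial i phi x ^+ 2 <= \sum_i partial i phi x ^+ 2.
    by rewrite (bigD1 i)//= lerDl sumr_ge0// => j _; exact: sqr_ge0.
  set S := \sum_i _; set p := partial i phi x; set y := phi x; set a := X x in x1 x2 * => pS.
  have a2 : a ^+ 2 <= r ^+ 2 by nra.
  have := sqr_ge0 (y + 2 * a * p).
  have : a ^+ 2 * p ^+ 2 <= r ^+ 2 * S.
    by apply: ler_pM => //; exact: sqr_ge0.
  nra.
set A := \int[leb]_(x in Omega) (phi x ^+ 2).
set B := \int[leb]_(x in Omega) (2 * _).
set C := \int[leb]_(x in Omega) _; lra.
Qed.

Lemma Rint_eq0_ae u : integrable_on u -> (forall x, Omega x -> 0 <= u x) ->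
  \int[leb]_(x in Omega) u x = 0 -> {ae leb, forall x, Omega x -> u x = 0}.
Proof.
move=> iu u0 h.
have h2 : (\int[leb]_(x in Omega) (u x)%:E = 0)%E.
  by rewrite -(fineK (integrable_fin_num mO iu)); congr EFin.
have /(ae_eq_integral_abs leb mO) : measurable_fun Omega (EFin \o u) by exact: measurable_int
  iu.
move=> [+ _].
have -> : (\int[leb]_(x in Omega) `|(EFin \o u) x| = 0)%E.
  rewrite -h2; apply: eq_integral => x; rewrite inE => Ox /=.
  by rewrite ger0_norm// u0.
move=> /(_ erefl); apply: filterS => x hx Ox.
by have := hx Ox => /= -[].
Qed.

(** If the gradient vanishes, v is a limit in L^2 of test functions whose gradients
    tend to 0, and these tend to 0 by [poincare]. *)
Lemma grad_dot_gt0 (i : 'I_n) v : H10 Omega v ->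
  ~ {ae leb, forall x, Omega x -> v x = 0} -> 0 < grad_dot Omega v v.
Proof.
move=> Hv nv; rewrite lt_neqAle grad_dot_ge0 andbT eq_sym; apply/negP => /eqP Ev.
have [r r0 Or] := bounded_cube bO.
have [[Lv _] _] := Hv; have [_ iv] := Lv.
have small d : 0 < d -> \int[leb]_(x in Omega) (v x ^+ 2) <= (8 * r ^+ 2 + 2) * d.
  move=> d0; have [phi [tphi h1 h2]] := H10_approx Hv d0.
  have := poincare i Or tphi; rewrite Ev add0r in h2.
  have Lphi := test_L2 tphi.
  have := Rint_sqrB_le Lphi (L2_comb 1 (-1) Lphi Lv).
  have -> : \int[leb]_(x in Omega) (phi x - (1 * phi x + -1 * v x)) ^+ 2 =
      \int[leb]_(x in Omega) (v x ^+ 2).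
    by apply: eq_Rintegral => x _; congr (_ ^+ 2); ring.
  have -> : \int[leb]_(x in Omega) ((1 * phi x + -1 * v x) ^+ 2) =
      \int[leb]_(x in Omega) ((v x - phi x) ^+ 2).
    by apply: eq_Rintegral => x _; ring.
  set A := \int[leb]_(x in Omega) _; set B := \int[leb]_(x in Omega) _ in h1 *.
  set C := \int[leb]_(x in Omega) _.
  move=> hA hC; apply: (le_trans hA).
  have r2 : 0 <= 4 * r ^+ 2 by rewrite mulr_ge0// sqr_ge0.
  have hC2 : C <= 4 * r ^+ 2 * d by rewrite (le_trans hC)// ler_wpM2l// ltW.
  have -> : (8 * r ^+ 2 + 2) * d = 2 * (4 * r ^+ 2 * d) + 2 * d by ring.
  by apply: lerD; rewrite ler_pM2l// ltW.
have I0 : \int[leb]_(x in Omega) (v x ^+ 2) = 0.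
  apply/eqP; rewrite eq_le; apply/andP; split; last first.
    by apply: Rintegral_ge0 => x _; exact: sqr_ge0.
  have c0 : 0 < 8 * r ^+ 2 + 2 by rewrite ltr_wpDl// mulr_ge0// sqr_ge0.
  apply/ler_addgt0Pl => e e0; rewrite addr0.
  by rewrite (le_trans (small (e / (8 * r ^+ 2 + 2)) _)) ?divr_gt0// mulrC divfK// lt0r_neq0.
apply: nv; have := Rint_eq0_ae iv (fun x _ => sqr_ge0 (v x)) I0.
by apply: filterS => x h Ox; apply/eqP; rewrite -sqrf_eq0 h.
Qed.

Lemma H10_norm_sq v : H10_norm Omega v ^+ 2 = grad_dot Omega v v.
Proof. by rewrite sqr_sqrtr// grad_dot_ge0. Qed.

End sobolev_theory.

(** * Integrals of powers of f(v) *)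

Section nonlin_continuity.
Context {R : realType}.
Variable f : R -> R.
Hypothesis f_dual : dual_change f.

Lemma continuous_normr_powR (p : R) : 0 < p -> continuous (fun s : R => `|s| `^ p).
Proof.
move=> p0 s; have [->|s0] := eqVneq s 0.
  rewrite /continuous_at normr0 powR0 ?lt0r_neq0//.
  apply/cvgr0Pnorm_lt => e e0; near=> t.
  rewrite ger0_norm ?powR_ge0//.
  have -> : e = (e `^ p^-1) `^ p by rewrite -powRrM mulVf ?powRr1 ?ltW// lt0r_neq0.
  apply: gt0_ltr_powR; rewrite ?nnegrE ?powR_ge0//.
  near: t; exact: (@nbhs0_lt R R _ (powR_gt0 _ e0)).
apply: (@continuous_comp R R R (fun u : R => `|u|) (fun a : R => a `^ p));
  first exact: norm_continuous.
apply: differentiable_continuous; apply/derivable1_diffP.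
by have [] := @is_derive1_powR R p `|s| (etrans (normr_gt0 _) s0).
Unshelve. all: by end_near. Qed.

Lemma continuous_dual_pow (p : R) : 0 < p -> continuous (fun s : R => `|f s| `^ p).
Proof.
move=> p0 s; apply: (@continuous_comp R R R f (fun a : R => `|a| `^ p)).
  exact: continuous_dual.
exact: continuous_normr_powR.
Qed.

Lemma continuous_nonlin (p : R) : 2 < p -> continuous (nonlin f p).
Proof.
move=> p2; have cf := continuous_dual f_dual.
have cd : continuous (derive1 f).
  rewrite (_ : derive1 f = fun t => (Num.sqrt (1 + 2 * f t ^+ 2))^-1); last first.
    by apply/funext => t; rewrite derive1_dual.
  move=> t; apply: cvgV.
    by rewrite lt0r_neq0// sqrtr_gt0 ltr_pwDl// mulr_ge0// sqr_ge0.
  apply: (@continuous_comp R R R (fun t => 1 + 2 * f t ^+ 2) Num.sqrt);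
    last exact: sqrt_continuous.
  apply: cvgD; first exact: cvg_cst.
  apply: cvgM; first exact: cvg_cst.
  by rewrite expr2; under eq_fun do rewrite expr2; apply: cvgM; exact: cf.
have cp : continuous (fun s => `|f s| `^ (p - 2)).
  by apply: continuous_dual_pow; rewrite subr_gt0.
move=> s; rewrite /nonlin; apply: cvgM; last exact: cvg_id.
apply: cvgM; last exact: cd.
by apply: cvgM; [exact: cp|exact: cf].
Qed.

End nonlin_continuity.

Section nehari_theory.
Context {R : realType} {n : nat}.
Variable Omega : set 'rV[R]_n.
Hypothesis oO : open Omega.
Hypothesis bO : bounded_set Omega.
Variable f : R -> R.
Hypothesis f_dual : dual_change f.
Local Notation leb := (lebesgue_rV R n).
Local Notation test := (test_function Omega).
Local Notation E u := (grad_dot Omega u u).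
Local Notation nl := (nonlin f).
Implicit Types (u w v phi : 'rV[R]_n -> R) (p t : R).
Let mO := measurable_Omega oO.

Lemma measurable_pow p v : 0 < p -> measurable_fun Omega v ->
  measurable_fun Omega (fun x => `|f (v x)| `^ p).
Proof.
move=> p0 mv; apply: (measurableT_comp (f := fun s => `|f s| `^ p)) mv.
by apply: continuous_measurable_fun; exact: continuous_dual_pow.
Qed.

Lemma measurable_nonlin p v : 2 < p -> measurable_fun Omega v ->
  measurable_fun Omega (fun x => nl p (v x)).
Proof.
move=> p0 mv; apply: (measurableT_comp (f := nl p)) mv.
by apply: continuous_measurable_fun; exact: continuous_nonlin.
Qed.

Lemma integrable_pow_test p phi : 0 < p -> test phi ->
  integrable_on Omega (fun x => `|f (phi x)| `^ p).
Proof.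
move=> p0 tphi; have [C C0 [h _]] := test_bounds tphi.
apply: (integrable_on_bounded oO bO (C := C `^ p)).
  exact: measurable_pow (test_measurable oO tphi).
move=> x _; rewrite ger0_norm ?powR_ge0//.
apply: ge0_ler_powR; rewrite ?nnegrE ?(ltW p0) ?(ltW C0)//.
exact: le_trans (dual_norm_le f_dual _) (h x).
Qed.

Lemma integrable_nonlin_of_pow p v : 2 < p -> measurable_fun Omega v ->
  integrable_on Omega (fun x => `|f (v x)| `^ p) -> integrable_on Omega (fun x => nl p (v x)).
Proof.
move=> p2 mv ip; have p0 : 0 < p by exact: lt_trans p2.
apply: (integrable_on_le oO _ ip); first exact: measurable_nonlin.
move=> x _; rewrite ger0_norm ?nonlin_ge0//.
by case/andP: (nonlin_bounds f_dual (v x) p0).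
Qed.

Lemma integrable_pow_of_nonlin p v : 2 < p -> measurable_fun Omega v ->
  integrable_on Omega (fun x => nl p (v x)) -> integrable_on Omega (fun x => `|f (v x)| `^ p).
Proof.
move=> p2 mv ip; have p0 : 0 < p by exact: lt_trans p2.
apply: (integrable_on_le oO _ (integrable_onZ oO 2 ip)); first exact: measurable_pow.
move=> x _; rewrite ger0_norm ?powR_ge0// mulrC -ler_pdivrMr//.
by case/andP: (nonlin_bounds f_dual (v x) p0).
Qed.

Lemma denergyE p v : denergy Omega f p v v =
  E v - \int[leb]_(x in Omega) nl p (v x).
Proof. by []. Qed.

Lemma energyE p v : energy Omega f p v =
  2^-1 * E v - p^-1 * \int[leb]_(x in Omega) (`|f (v x)| `^ p).
Proof. by rewrite /energy H10_norm_sq. Qed.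

(** An infinite integral of the nonnegative function nonlin would be read as 0 and
    force ||v|| = 0, against [grad_dot_gt0]. *)
Lemma nehari_facts (i0 : 'I_n) p v : 2 < p -> nehari Omega f p v ->
  [/\ 0 < E v, integrable_on Omega (fun x => nl p (v x)),
    integrable_on Omega (fun x => `|f (v x)| `^ p)
    & E v = \int[leb]_(x in Omega) nl p (v x)].
Proof.
move=> p2 [Hv nv]; rewrite denergyE => /eqP; rewrite subr_eq0 => /eqP Ev.
have E0 := grad_dot_gt0 oO bO i0 Hv nv.
have mv : measurable_fun Omega v by case: Hv => -[[]].
have inl : integrable_on Omega (fun x => nl p (v x)).
  apply/integrableP; split; first by apply/measurable_EFinP; exact: measurable_nonlin.
  rewrite ltey; apply/negP => /eqP h.
  move: E0; rewrite Ev /Rintegral.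
  have -> : (\int[leb]_(x in Omega) (nl p (v x))%:E = +oo)%E.
    rewrite -h; apply: eq_integral => x _ /=.
    by rewrite ger0_norm ?nonlin_ge0.
  by rewrite ltxx.
by split => //; exact: integrable_pow_of_nonlin.
Qed.

(** On N_p, I_p(v) is the integral of nonlin / 2 - |f|^p / p, and nonlin is at
    least |f|^p / 2; so I_p(v) >= (1/4 - 1/p) int |f(v)|^p. *)
Lemma energy_nehari_ge0 (i0 : 'I_n) p v : 4 < p -> nehari Omega f p v ->
  0 <= energy Omega f p v.
Proof.
move=> p4 Nv; have p2 : 2 < p by apply: lt_trans p4; rewrite ltr_nat.
have p0 : 0 < p by exact: lt_trans p2.
have [E0 i1 i2 Ev] := nehari_facts i0 p2 Nv.
have i3 : integrable_on Omega (fun x => 2 * nl p (v x)) by exact: (integrable_onZ oO).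
have := Rint_le oO i2 i3.
have h x : Omega x -> `|f (v x)| `^ p <= 2 * nl p (v x).
  rewrite mulrC -ler_pdivrMr// => _.
  by case/andP: (nonlin_bounds f_dual (v x) p0).
move=> /(_ h); rewrite RintZ// -Ev energyE.
have : 0 <= \int[leb]_(x in Omega) (`|f (v x)| `^ p).
  by apply: Rintegral_ge0 => x _; exact: powR_ge0.
have : p^-1 <= 4^-1 by rewrite lef_pV2 ?posrE// ltW.
move: (E v) (\int[leb]_(x in Omega) `|f (v x)| `^ p) => a b hp b0 ba.
have : p^-1 * b <= 4^-1 * b by rewrite ler_wpM2r.
lra.
Qed.

Lemma energy_testE p t phi : test phi ->
  energy Omega f p (fun x => t * phi x) = t ^+ 2 / 2 * E phi -
    p^-1 * \int[leb]_(x in Omega) (`|f (t * phi x)| `^ p).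
Proof. by move=> tphi; rewrite energyE grad_dot_testZ//; congr (_ - _); move: (E phi) => a;
  ring. Qed.

(** On a set of positive measure |v| exceeds some d > 0, and there |f(t v)|^p is at
    least a multiple of t^(p/2) for t >= 1/d, with p/2 > 2. *)
Lemma superquadratic p v (C : R) : 4 < p -> measurable_fun Omega v ->
  ~ {ae leb, forall x, Omega x -> v x = 0} ->
  exists2 T, 1 <= T & forall t, T <= t ->
   ((C * t ^+ 2)%:E <= \int[leb]_(x in Omega) (`|f (t * v x)| `^ p)%:E)%E.
Proof.
move=> p4 mv nv; have p0 : 0 < p by exact: lt_trans p4.
pose A k := Omega `&` [set x | (k.+1%:R^-1 < `|v x|)%R].
have mA k : measurable (A k).
  have mnv : measurable_fun Omega (fun x => `|v x|) by exact: measurableT_comp.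
  have := mnv mO `]k.+1%:R^-1, +oo[%classic (measurable_itv _).
  congr measurable; congr (_ `&` _); apply/seteqP; split=> x /=; by rewrite in_itv/= andbT.
have [k Ak] : exists k, (0 < leb (A k))%E.
  apply: contrapT => /forallNP h; apply: nv.
  have h0 k : leb (A k) = 0%E.
    apply/eqP; rewrite eq_le measure_ge0 andbT leNgt; exact/negP.
  have : leb.-negligible (\bigcup_k A k).
    by apply: negligible_bigcup => k; exists (A k); split; [exact: mA|exact: h0|].
  apply: negligibleS => x /= /not_implyP[Ox vx].
  have vx0 : 0 < `|v x| by rewrite normr_gt0; exact/eqP.
  have [k _ /(_ k (leqnn k)) hk] := near_infty_natSinv_lt (PosNum vx0).
  by exists k.
set d := k.+1%:R^-1 : R; have d0 : 0 < d by rewrite invr_gt0.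
have Afin : (leb (A k) < +oo)%E.
  apply: le_lt_trans (lebesgue_Omega oO bO).
  by apply: le_measure; rewrite ?inE//; exact: subIsetl.
set m := fine (leb (A k)).
have mE : leb (A k) = m%:E by rewrite fineK// ge0_fin_numE.
have m0 : 0 < m by rewrite -lte_fin -mE.
pose b := f 1 ^+ 2 * d; have b0 : 0 < b.
  by rewrite mulr_gt0// exprn_gt0// dual_gt0.
pose a := p / 2 - 2; have a0 : 0 < a by rewrite /a subr_gt0 ltr_pdivlMr//; lra.
pose K := Num.max 1 (C / (b ^+ 2 * m)).
have K1 : 1 <= K by rewrite le_max lexx.
(* For t >= T one has (b t)^(p/2 - 2) >= K, which yields the constant C. *)
pose T := Num.max 1 (Num.max d^-1 (K `^ a^-1 / b)).
exists T; first by rewrite le_max lexx.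
move=> t; rewrite !ge_max => /and3P[t1 td tb].
have t0 : 0 < t by exact: lt_le_trans t1.
have bt0 : 0 <= b * t by apply: mulr_ge0; exact: ltW.
have btK : K <= (b * t) `^ a.
  have -> : K = (K `^ a^-1) `^ a.
    by rewrite -powRrM mulVf ?powRr1 ?(le_trans _ K1)// lt0r_neq0.
  apply: ge0_ler_powR; rewrite ?nnegrE ?powR_ge0 ?bt0 ?(ltW a0)//.
  by rewrite mulrC -ler_pdivrMr.
have pE : (b * t) `^ (p / 2) = (b * t) `^ a * (b * t) ^+ 2.
  by rewrite -powR_natD// /a subrK// lt0r_neq0 ?divr_gt0.
have low x : A k x -> (b * t) `^ (p / 2) <= `|f (t * v x)| `^ p.
  move=> [Ox /= kx].
  have tv1 : 1 <= `|t * v x|.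
    rewrite normrM gtr0_norm// (le_trans (y := t * d))//.
      by rewrite -ler_pdivrMr// div1r.
    by rewrite ler_pM2l// ltW.
  apply: le_trans (dual_growth f_dual p0 tv1).
  apply: ge0_ler_powR; rewrite ?nnegrE ?bt0 ?(divr_ge0 (ltW p0))// ?(mulr_ge0 (sqr_ge0 _))//.
  rewrite /b -mulrA ler_wpM2l ?sqr_ge0// normrM gtr0_norm// mulrC ler_pM2l//.
  exact: ltW.
apply: (@le_trans _ _ (\int[leb]_(x in A k) ((b * t) `^ (p / 2))%:E)%E).
  rewrite integral_cst; last exact: mA.
  rewrite [X in (_ * X)%E]mE -EFinM lee_fin pE.
  have h : C <= K * (b ^+ 2 * m).
    have bm : 0 < b ^+ 2 * m by rewrite mulr_gt0// exprn_gt0.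
    by rewrite -ler_pdivrMr// le_max lexx orbT.
  have h2 : 0 <= t ^+ 2 by exact: sqr_ge0.
  have h3 : 0 <= b ^+ 2 * m by rewrite mulr_ge0 ?sqr_ge0 ?ltW.
  have h4 : K * (b ^+ 2 * m) <= (b * t) `^ a * (b ^+ 2 * m) by rewrite ler_wpM2r.
  have -> : (b * t) `^ a * (b * t) ^+ 2 * m = ((b * t) `^ a * (b ^+ 2 * m)) * t ^+ 2 by ring.
  by rewrite ler_wpM2r// (le_trans h).
have mtv : measurable_fun Omega (fun x => t * v x) by exact: measurable_funM.
have mp := measurable_pow p0 mtv; have mAk := mA k.
apply: (@le_trans _ _ (\int[leb]_(x in A k) (`|f (t * v x)| `^ p)%:E)%E).
  apply: ge0_le_integral; first exact: mAk.
  - by move=> x _; rewrite lee_fin powR_ge0.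
  - exact: measurable_cst.
  - by apply/measurable_EFinP; apply: measurable_funS mp => //; exact: subIsetl.
  - by move=> x Ax; rewrite lee_fin low.
apply: ge0_subset_integral; [exact: mAk|exact: mO| | |exact: subIsetl].
- exact/measurable_EFinP.
- by move=> x _; rewrite lee_fin powR_ge0.
Qed.

End nehari_theory.

(** * Two facts on sequences of functions *)

Section sequences_of_functions.
Context d (T : measurableType d) (R : realType).
Variable mu : {measure set T -> \bar R}.
Variable D : set T.
Hypothesis mD : measurable D.

Lemma lt_limn_einf (u : (\bar R)^nat) (c : \bar R) : (c < limn_einf u)%E ->
  \forall k \near \oo, (c < u k)%E.
Proof.
rewrite limn_einf_lim (cvg_lim _ (@cvg_einfs_sup _ u))// => /ereal_sup_gt[_ [k _ <-] cu].
near=> m; apply: (lt_le_trans cu); apply: ereal_inf_lbound; exists m => //=.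
by near: m; exact: nbhs_infty_ge.
Unshelve. all: by end_near. Qed.

(** The series of the w_k^2 has a finite integral, so it converges a.e. *)
Lemma ae_cvg0_of_summable (w : nat -> T -> R) :
  (forall k, mu.-integrable D (fun x => (w k x ^+ 2)%:E)) ->
  (forall k, (\int[mu]_(x in D) (w k x ^+ 2)%:E <= (1 / (2 ^ k.+1)%:R)%:E)%E) ->
  {ae mu, forall x, D x -> w k x @[k --> \oo] --> (0 : R)}.
Proof.
move=> iw hw; pose g k x := (w k x ^+ 2)%:E.
have g0 k x : (0 <= g k x)%E by rewrite lee_fin sqr_ge0.
have mg k : measurable_fun D (g k) by exact: measurable_int (iw k).
have S1 : (\int[mu]_(x in D) (\sum_(k <oo) g k x) <= 1%:E)%E.
  rewrite integral_nneseries//; apply: le_trans (@epsilon_trick0 R 1 xpredT ler01).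
  apply: lee_nneseries => k *; [exact: integral_ge0|exact: hw].
have iS : mu.-integrable D (fun x => \sum_(k <oo) g k x)%E.
  apply/integrableP; split; first exact: ge0_emeasurable_sum.
  apply: (le_lt_trans _ (ltry 1)); apply: le_trans S1.
  rewrite le_eqVlt; apply/orP; left; apply/eqP; apply: eq_integral => x _.
  by rewrite gee0_abs// nneseries_ge0.
have := integrable_ae mD iS.
apply: filterS => x hx Dx; have fx := hx Dx.
have Sfin : (\sum_(0 <= k <oo) g k x < +oo)%E by rewrite -ge0_fin_numE// nneseries_ge0.
have tail := nneseries_tail_cvg (P := xpredT) Sfin (fun k _ => g0 k x).
have sq0 : g k x @[k --> \oo] --> 0%E.
  apply: (squeeze_cvge _ (cvg_cst 0%E) tail); apply: nearW => k; rewrite g0/=.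
  rewrite (le_trans _ (nneseries_lim_ge k.+1 (fun i _ _ => g0 i x)))//.
  by rewrite big_nat1.
have {}sq0 : w k x ^+ 2 @[k --> \oo] --> (0 : R).
  exact: (fine_cvg sq0).
apply/cvgr0Pnorm_lt => e e0.
have /cvgrPdist_lt/(_ _ (exprn_gt0 2 e0)) := sq0.
apply: filterS => k /=; rewrite sub0r normrN ger0_norm ?sqr_ge0//.
rewrite -(real_normK (num_real (w k x))).
by rewrite ltr_pXn2r ?nnegrE ?(ltW e0).
Qed.

End sequences_of_functions.

Section envelope.
Context {R : realType}.

(** Upper bounds that hold eventually for each t hold eventually for all t at once:
    a finite grid of values of t with ratios close to 1 suffices, because by
    hypothesis e k t / t^2 decreases in t.  The bound near t = 0 comes from A t^2,
    and that beyond T from the sign of e k T. *)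
Lemma eventually_le_of_pointwise (e : nat -> R -> R) (m A : R) (eps : R) :
  0 <= m -> 0 < A -> 0 < eps ->
  (forall k s t, 0 < s -> s <= t -> e k t <= (t / s) ^+ 2 * e k s) ->
  (forall s eta, 0 < s -> 0 < eta -> \forall k \near \oo, e k s <= m + eta) ->
  (exists2 T, 0 < T & \forall k \near \oo, e k T <= 0) ->
  (forall k t, e k t <= A * t ^+ 2) ->
  \forall k \near \oo, forall t, 0 < t -> e k t <= m + eps.
Proof.
move=> m0 A0 eps0 quad pt [T T0 eT] small.
(* For t <= s0, A t^2 <= eps. *)
pose s0 := Num.sqrt (eps / A).
have s00 : 0 < s0 by rewrite sqrtr_gt0 divr_gt0.
have s02 : s0 ^+ 2 = eps / A by rewrite sqr_sqrtr// ltW// divr_gt0.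
have m2 : 0 < m + eps / 2 by rewrite ltr_wpDl// divr_gt0.
(* Multiplying m + eps / 2 by the square of the ratio th gives m + eps. *)
pose th2 := (m + eps) / (m + eps / 2).
have th21 : 1 < th2 by rewrite ltr_pdivlMr// mul1r ltrD2l ltr_pdivrMr// mulr_natr ltr_pwDr.
pose th := Num.sqrt th2.
have th1 : 1 < th by rewrite -sqrtr1 ltr_sqrt// (lt_trans _ th21).
have thsq : th ^+ 2 * (m + eps / 2) = m + eps.
  by rewrite sqr_sqrtr ?(ltW (lt_trans _ th21))// /th2 divfK// lt0r_neq0.
(* Successive points s0 + h j have a ratio of at most th. *)
pose h := s0 * (th - 1).
have h0 : 0 < h by rewrite mulr_gt0// subr_gt0.
pose pos j := s0 + h * j%:R.
have posge j : s0 <= pos j by rewrite lerDl mulr_ge0// ltW.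
have grid J : \forall k \near \oo, forall t, 0 < t -> t <= pos J -> e k t <= m + eps.
  elim: J => [|J IH].
    near=> k => t t0; rewrite /pos mulr0 addr0 => ts.
    rewrite (le_trans (small k t))//.
    have : t ^+ 2 <= s0 ^+ 2 by rewrite lerXn2r ?nnegrE// ltW.
    rewrite s02 ler_pdivlMr// mulrC => /le_trans; apply.
    by rewrite lerDr.
  have pJ : 0 < pos J by exact: lt_le_trans (posge J).
  have pt' := pt _ _ pJ (divr_gt0 eps0 (ltr0n R 2)).
  near=> k => t t0 tJ.
  have [tp|/ltW tp] := leP t (pos J).
    have H : forall t, 0 < t -> t <= pos J -> e k t <= m + eps by near: k.
    exact: H.
  apply: (le_trans (quad k _ _ pJ tp)).
  have ek : e k (pos J) <= m + eps / 2 by near: k.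
  apply: (@le_trans _ _ ((t / pos J) ^+ 2 * (m + eps / 2))).
    by rewrite ler_wpM2l// sqr_ge0.
  rewrite -thsq ler_wpM2r ?(ltW m2)//.
  rewrite lerXn2r ?nnegrE ?(ltW (lt_trans ltr01 th1)) ?divr_ge0 ?(ltW t0) ?(ltW pJ)//.
  rewrite ler_pdivrMr// (le_trans tJ)//.
  have -> : pos J.+1 = pos J + h by rewrite /pos -natr1; ring.
  have -> : th * pos J = pos J + (th - 1) * pos J by ring.
  by rewrite lerD2l /h mulrC ler_pM2l ?subr_gt0// posge.
have [J TJ] : exists J, T <= pos J.
  exists (Num.bound (T / h)); rewrite /pos.
  have := archi_boundP (divr_ge0 (ltW T0) (ltW h0)).
  rewrite ltr_pdivrMr// => /ltW TB; rewrite (le_trans TB)// mulrC.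
  by rewrite lerDr ltW.
have gJ := grid J.
near=> k => t t0; have [tT|/ltW tT] := leP t T.
  have H : forall t, 0 < t -> t <= pos J -> e k t <= m + eps by near: k.
  by apply: H => //; exact: le_trans TJ.
rewrite (le_trans (quad k _ _ T0 tT))//.
have ek : e k T <= 0 by near: k.
by rewrite (@le_trans _ _ 0)// ?addr_ge0 ?(ltW eps0)// mulr_ge0_le0// sqr_ge0.
Unshelve. all: by end_near. Qed.

End envelope.

(** * Energies along rays *)

Section levels.
Context {R : realType} {n : nat}.
Variable Omega : set 'rV[R]_n.
Hypothesis oO : open Omega.
Hypothesis bO : bounded_set Omega.
Variable f : R -> R.
Hypothesis f_dual : dual_change f.
Local Notation leb := (lebesgue_rV R n).
Local Notation test := (test_function Omega).
Local Notation E u := (grad_dot Omega u u).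
Local Notation nl := (nonlin f).
Local Notation I := (energy Omega f).
Local Notation ae0 v := {ae leb, forall x, Omega x -> v x = 0}.
Implicit Types (u w v phi : 'rV[R]_n -> R) (p t : R).
Let mO := measurable_Omega oO.

(** The tangent inequality [dual_pow_convex] with nonlin >= |f|^p / 2 >= 2 |f|^p / p. *)
Lemma dual_pow_quad p (r y : R) : 4 < p -> 1 <= r ->
  r ^+ 2 * `|f y| `^ p <= `|f (r * y)| `^ p.
Proof.
move=> p4 r1; have p0 : 0 < p by exact: lt_trans p4.
have r0 : 0 <= r by exact: le_trans r1.
have := dual_pow_convex f_dual y p4 r0.
have /andP[h _] := nonlin_bounds f_dual y p0.
set F := `|f y| `^ p in h *; set G := `|f (r * y)| `^ p; set N := nl p y in h *.
have F0 : 0 <= F by exact: powR_ge0.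
have r2 : 0 <= (r ^+ 2 - 1) / 2 by rewrite divr_ge0// subr_ge0 exprn_ege1.
move=> H; rewrite -(ler_pM2r (_ : 0 < p^-1)) ?invr_gt0//.
apply: le_trans H.
have H2 : (r ^+ 2 - 1) / 2 * (F / 2) <= (r ^+ 2 - 1) / 2 * N by rewrite ler_wpM2l.
apply: (@le_trans _ _ (F / p + (r ^+ 2 - 1) / 2 * (F / 2))); last by rewrite lerD2l.
have -> : r ^+ 2 * F / p = F / p + (r ^+ 2 - 1) * F * p^-1 by ring.
have -> : (r ^+ 2 - 1) / 2 * (F / 2) = (r ^+ 2 - 1) * F * 4^-1 by field.
rewrite lerD2l ler_wpM2l//; last by rewrite lef_pV2 ?posrE// ltW.
by rewrite mulr_ge0// subr_ge0 exprn_ege1.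
Qed.

Lemma energy_test_quad p phi (s t : R) : 4 < p -> test phi -> 0 < s -> s <= t ->
  I p (fun x => t * phi x) <= (t / s) ^+ 2 * I p (fun x => s * phi x).
Proof.
move=> p4 tphi s0 st; have p0 : 0 < p by exact: lt_trans p4.
rewrite !energy_testE// mulrBr.
have -> : (t / s) ^+ 2 * (s ^+ 2 / 2 * E phi) = t ^+ 2 / 2 * E phi.
  by move: (E phi) => a; field; exact: lt0r_neq0.
rewrite lerD2l lerN2 mulrCA ler_wpM2l ?invr_ge0 ?(ltW p0)//.
have is_ := integrable_pow_test oO bO f_dual p0 (testZ s tphi).
have it := integrable_pow_test oO bO f_dual p0 (testZ t tphi).
rewrite -(RintZ oO)//; apply: (Rint_le oO) => //; first exact: (integrable_onZ oO).
move=> x _; have -> : t * phi x = (t / s) * (s * phi x).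
  by move: (phi x) => a; field; exact: lt0r_neq0.
by apply: dual_pow_quad => //; rewrite ler_pdivlMr// mul1r.
Qed.

Lemma energy_test_le p phi t : 0 < p -> test phi ->
  I p (fun x => t * phi x) <= t ^+ 2 / 2 * E phi.
Proof.
move=> p0 tphi; rewrite energy_testE// gerBl mulr_ge0 ?invr_ge0 ?(ltW p0)//.
by apply: Rintegral_ge0 => x _; exact: powR_ge0.
Qed.

Lemma energy_test_lt p phi t (C : R) : 0 < p -> test phi ->
  (C%:E < \int[leb]_(x in Omega) (`|f (t * phi x)| `^ p)%:E)%E ->
  I p (fun x => t * phi x) <= t ^+ 2 / 2 * E phi - p^-1 * C.
Proof.
move=> p0 tphi h; rewrite energy_testE// lerD2l lerN2 ler_wpM2l ?invr_ge0 ?(ltW p0)//.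
have it := integrable_pow_test oO bO f_dual p0 (testZ t tphi).
rewrite -lee_fin /Rintegral fineK; first exact: ltW.
exact: integrable_fin_num.
Qed.

(** This is I_p(t v) <= I_p(v), written so that it also covers the case where
    the integral of |f(t v)|^p is infinite. *)
Lemma nehari_ray (i0 : 'I_n) p v t : 4 < p -> nehari Omega f p v -> 0 <= t ->
  ((p * (t ^+ 2 / 2 * E v - I p v))%:E <=
     \int[leb]_(x in Omega) (`|f (t * v x)| `^ p)%:E)%E.
Proof.
move=> p4 Nv t0; have p0 : 0 < p by exact: lt_trans p4.
have p2 : 2 < p by apply: lt_trans p4; rewrite ltr_nat.
have [E0 i1 i2 Ev] := nehari_facts oO bO f_dual i0 p2 Nv.
have mv : measurable_fun Omega v by case: Nv => -[[[]]].
have mp : measurable_fun Omega (fun x => `|f (t * v x)| `^ p).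
  by apply: measurable_pow => //; exact: measurable_funM.
have [fin|] := boolP ((\int[leb]_(x in Omega) (`|f (t * v x)| `^ p)%:E < +oo)%E); last first.
  by rewrite -leNgt leye_eq => /eqP ->; rewrite leey.
have it : integrable_on Omega (fun x => `|f (t * v x)| `^ p).
  apply/integrableP; split; first exact/measurable_EFinP.
  apply: le_lt_trans fin; rewrite le_eqVlt; apply/orP; left; apply/eqP.
  by apply: eq_integral => x _ /=; rewrite ger0_norm ?powR_ge0.
rewrite -(fineK (integrable_fin_num mO it)) lee_fin.
change (p * (t ^+ 2 / 2 * E v - I p v) <= \int[leb]_(x in Omega) (`|f (t * v x)| `^ p)).
rewrite energyE.
have -> : p * (t ^+ 2 / 2 * E v - (2^-1 * E v - p^-1 * \int[leb]_(x in Omega) `|f (v x)| `^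
  p)) =
    \int[leb]_(x in Omega) `|f (v x)| `^ p + (p * ((t ^+ 2 - 1) / 2)) * E v.
  by move: (E v) (\int[leb]_(x in Omega) `|f (v x)| `^ p) => a b; field; exact: lt0r_neq0.
rewrite Ev -(RintZ oO)// -(RintD oO)//; last exact: (integrable_onZ oO).
apply: (Rint_le oO) => //; first by apply: (integrable_onD oO) => //;
  exact: (integrable_onZ oO).
move=> x _; have := dual_pow_convex f_dual (v x) p4 t0.
rewrite -(ler_pM2l p0) mulrDr => h; apply: le_trans (le_trans h _).
  by rewrite le_eqVlt; apply/orP; left; apply/eqP;
    move: (`|f (v x)| `^ p) (nl p (v x)) => a b; field; exact: lt0r_neq0.
by rewrite mulrC divfK// lt0r_neq0.
Qed.

(** Fatou's lemma, as the lower semicontinuity of the integral of |f(t v)|^p. *)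
Lemma fatou_pow p v (phi : nat -> 'rV[R]_n -> R) t (C : R) : 0 < p ->
  measurable_fun Omega v -> (forall k, test (phi k)) ->
  {ae leb, forall x, Omega x -> phi k x @[k --> \oo] --> v x} ->
  (C%:E < \int[leb]_(x in Omega) (`|f (t * v x)| `^ p)%:E)%E ->
  \forall k \near \oo, (C%:E < \int[leb]_(x in Omega) (`|f (t * phi k x)| `^ p)%:E)%E.
Proof.
move=> p0 mv tphi cphi hC.
pose g k x := (`|f (t * phi k x)| `^ p)%:E.
have mg k : measurable_fun Omega (g k).
  by apply/measurable_EFinP; exact: (measurable_pow f_dual p0 (test_measurable oO (testZ t
    (tphi k)))).
apply: lt_limn_einf; apply: (lt_le_trans hC).
apply: le_trans (fatou leb mO mg _); last by move=> k x _; rewrite lee_fin powR_ge0.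
rewrite le_eqVlt; apply/orP; left; apply/eqP; apply: ae_eq_integral => //.
- apply/measurable_EFinP; apply: (measurable_pow f_dual p0 (v := fun x => t * v x)).
  exact: measurable_funM.
- by rewrite /limn_einf; apply: measurableT_comp => //; apply: measurable_fun_limn_esup => k;
  exact: measurableT_comp.
- apply: filterS cphi => x hx Ox; apply/esym.
  suff h : g k x @[k --> \oo] --> (`|f (t * v x)| `^ p)%:E by have [-> _] :=
    cvg_limn_einf_sup h.
  apply: cvg_EFin; first exact: nearW.
  have ht : t * phi k x @[k --> \oo] --> t * v x.
    by apply: cvgM; [exact: cvg_cst|exact: hx].
  have cp := @continuous_dual_pow R f f_dual p p0 (t * v x).
  exact: (@continuous_cvg _ R R \oo _ _ (fun s : R => `|f s| `^ p) (t * v x) cp ht).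
Qed.

(* Summable tolerances, for the convergence almost everywhere. *)
Let dk (k : nat) : R := 1 / (2 ^ k.+1)%:R.

Let dk_gt0 k : 0 < dk k.
Proof. by rewrite divr_gt0// ltr0n expn_gt0. Qed.

Let dk_le1 k : dk k <= 1.
Proof. by rewrite ler_pdivrMr ?ltr0n ?expn_gt0// mul1r ler1n expn_gt0. Qed.

Let dk_small (e : R) : 0 < e -> \forall k \near \oo, dk k < e.
Proof.
move=> e0; have := near_infty_natSinv_lt (PosNum e0).
apply: filterS => k /=; apply: le_lt_trans.
by rewrite /dk div1r lef_pV2 ?posrE ?ltr0n ?expn_gt0// ler_nat ltnW// ltn_expl.
Qed.

(** A sequence of test functions that converges to v in H^1 and a.e. is eventually
    suitable, by [fatou_pow] for each t and [eventually_le_of_pointwise]. *)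
Lemma test_approx (i0 : 'I_n) p v (eps : R) : 4 < p -> nehari Omega f p v -> 0 < eps ->
  exists phi, [/\ test phi, ~ ae0 phi &
    forall t, 0 < t -> I p (fun x => t * phi x) <= I p v + eps].
Proof.
move=> p4 Nv eps0; have p0 : 0 < p by exact: lt_trans p4.
have [Hv nv _] := Nv; have [[Lv _] _] := Hv; have [mv iv] := Lv.
have Iv0 := energy_nehari_ge0 oO bO f_dual i0 p4 Nv.
have Ev0 := grad_dot_ge0 Omega v.
have /choice[phi hphi] : forall k, exists phi, [/\ test phi,
    \int[leb]_(x in Omega) ((v x - phi x) ^+ 2) < dk k & E phi < E v + dk k].
  by move=> k; have := H10_approx oO bO Hv (dk_gt0 k).
have tphi k : test (phi k) by case: (hphi k).
have iw k : integrable_on Omega (fun x => (v x - phi k x) ^+ 2).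
  have [_] := L2_comb oO 1 (-1) Lv (test_L2 oO bO (tphi k)).
  by under eq_fun do rewrite mul1r mulN1r.
have cphi : {ae leb, forall x, Omega x -> phi k x @[k --> \oo] --> v x}.
  have h k : (\int[leb]_(x in Omega) ((v x - phi k x) ^+ 2)%:E <= (1 / (2 ^ k.+1)%:R)%:E)%E.
    rewrite -(fineK (integrable_fin_num mO (iw k))) lee_fin.
    by case: (hphi k) => _ /ltW.
  have := ae_cvg0_of_summable mO iw h.
  apply: filterS => x hx Ox; have {}hx := hx Ox.
  rewrite (_ : phi ^~ x = (fun k => v x - (v x - phi k x))); last first.
    by apply/funext => k; rewrite subKr.
  rewrite -[X in _ --> X]subr0; apply: cvgB => //; exact: cvg_cst.
have Ek k : E (phi k) <= E v + dk k by case: (hphi k) => _ _ /ltW.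
have near_env : \forall k \near \oo, forall t, 0 < t ->
    I p (fun x => t * phi k x) <= I p v + eps.
  apply: (@eventually_le_of_pointwise _ (fun k t => I p (fun x => t * phi k x))
    (I p v) ((E v + 1) / 2)) => //.
  - by rewrite divr_gt0// ltr_wpDl.
  - by move=> k s t s0 st; exact: energy_test_quad.
  - move=> s eta s0 eta0.
    (* With this C, s^2 / 2 ||v||^2 - C / p equals I_p(v) + eta / 2. *)
    pose C := p * (s ^+ 2 / 2 * E v - I p v) - p * (eta / 2).
    have CF : (C%:E < \int[leb]_(x in Omega) (`|f (s * v x)| `^ p)%:E)%E.
      apply: lt_le_trans (nehari_ray i0 p4 Nv (ltW s0)).
      by rewrite lte_fin gtrBl mulr_gt0// divr_gt0.
    have nF := fatou_pow p0 mv tphi cphi CF.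
    have ns : \forall k \near \oo, dk k < eta / s ^+ 2.
      by apply: dk_small; rewrite divr_gt0// exprn_gt0.
    near=> k.
    have hF : (C%:E < \int[leb]_(x in Omega) (`|f (s * phi k x)| `^ p)%:E)%E by near: k.
    have hs : dk k < eta / s ^+ 2 by near: k.
    rewrite (le_trans (energy_test_lt p0 (tphi k) hF))//.
    have -> : s ^+ 2 / 2 * E (phi k) - p^-1 * C =
      I p v + eta / 2 + s ^+ 2 / 2 * (E (phi k) - E v).
      by rewrite /C; move: (E (phi k)) (E v) (I p v) => a b c; field; exact: lt0r_neq0.
    rewrite -addrA lerD2l [leRHS]splitr lerD2l.
    rewrite ltr_pdivlMr ?exprn_gt0// in hs.
    rewrite (@le_trans _ _ (s ^+ 2 / 2 * dk k))//.
      by rewrite ler_wpM2l ?divr_ge0 ?sqr_ge0// lerBlDl.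
    by rewrite mulrAC ler_pM2r ?invr_gt0// mulrC ltW.
  - have [T T1 hT] := superquadratic oO bO f_dual (p * (E v + 1)) p4 mv nv.
    have T0 : 0 < T by exact: lt_le_trans T1.
    exists T => //; pose C := p * ((E v + 1) * T ^+ 2 / 2).
    have CF : (C%:E < \int[leb]_(x in Omega) (`|f (T * v x)| `^ p)%:E)%E.
      apply: lt_le_trans (hT T (lexx _)).
      rewrite lte_fin /C -[ltRHS]mulrA ltr_pM2l// ltr_pdivrMr// mulr_natr mulr2n ltrDl.
      by rewrite mulr_gt0 ?exprn_gt0// ltr_wpDl.
    have nF := fatou_pow p0 mv tphi cphi CF.
    near=> k.
    have hF : (C%:E < \int[leb]_(x in Omega) (`|f (T * phi k x)| `^ p)%:E)%E by near: k.
    rewrite (le_trans (energy_test_lt p0 (tphi k) hF))//.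
    have -> : T ^+ 2 / 2 * E (phi k) - p^-1 * C = T ^+ 2 / 2 * (E (phi k) - (E v + 1)).
      by rewrite /C; move: (E (phi k)) (E v) => a b; field; exact: lt0r_neq0.
    rewrite mulr_ge0_le0 ?divr_ge0 ?sqr_ge0// subr_le0 (le_trans (Ek k))//.
    by rewrite lerD2l.
  - move=> k t; rewrite (le_trans (energy_test_le t p0 (tphi k)))//.
    rewrite [leRHS]mulrAC -[leRHS]mulrA [leRHS]mulrC ler_wpM2l ?divr_ge0 ?sqr_ge0//.
    by rewrite (le_trans (Ek k))// lerD2l.
have v2 : 0 < \int[leb]_(x in Omega) (v x ^+ 2).
  rewrite lt_neqAle Rintegral_ge0 ?andbT; last by move=> x _; exact: sqr_ge0.
  apply/eqP => /esym v20; apply: nv.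
  have := Rint_eq0_ae oO iv (fun x _ => sqr_ge0 (v x)) v20.
  by apply: filterS => x h Ox; apply/eqP; rewrite -sqrf_eq0 h.
have nz := dk_small v2.
have [k [hk1 hk2]] : exists k, (forall t, 0 < t -> I p (fun x => t * phi k x) <= I p v + eps) /\
    dk k < \int[leb]_(x in Omega) (v x ^+ 2).
  apply: (@filter_ex _ \oo); near=> k; split; by near: k.
exists (phi k); split=> // phi0.
have [_ + _] := hphi k; rewrite (_ : \int[leb]_(x in Omega) _ = \int[leb]_(x in Omega) (v x
  ^+ 2)).
  by rewrite ltNge (ltW hk2).
apply: (Rint_ae oO); first exact: integrable_on_measurable (iw k).
  exact: integrable_on_measurable iv.
by apply: filterS phi0 => x h Ox; rewrite h// subr0.
Unshelve. all: by end_near. Qed.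

End levels.

(** * Existence of nonzero test functions *)

Section nontrivial.
Context {R : realType}.

(** As for [lebesgue_rV_cube], by induction on the dimension. *)
Lemma lebesgue_rV_open_cube_gt0 n (c : 'rV[R]_n) (r : R) : 0 < r ->
  (0 < lebesgue_rV R n (open_cube c r))%E.
Proof.
move=> r0; elim: n c => [|n IH] c.
  rewrite /= diracE mem_set; first by rewrite lte_fin ltr01.
  by case.
rewrite /= /lebesgue_rV_step /pushforward.
pose c' : 'rV[R]_n := \row_j c ord0 (lift ord0 j).
rewrite (_ : _ @^-1` _ = (`]c ord0 ord0 - r, c ord0 ord0 + r[ `*` open_cube c' r)); last first.
  apply/seteqP; split=> [[s y]/= h|[s y]/= [s0 h] i].
    split; first by have := h ord0; rewrite cons_rV0/= in_itv/= ltr_distl.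
    by move=> i; have := h (lift ord0 i); rewrite cons_rVS mxE.
  have [j ->|->] := unliftP ord0 i; rewrite ?cons_rVS ?cons_rV0//=.
    by have := h j; rewrite mxE.
  by move: s0; rewrite in_itv/= ltr_distl.
rewrite product_measure1E//=; last exact: measurable_open_cube.
rewrite mule_gt0//.
rewrite lebesgue_measure_itv/= lte_fin ifT.
  by rewrite -EFinB lte_fin; lra.
lra.
Qed.

Lemma test_nonzero n (Omega : set 'rV[R]_n) : open Omega -> Omega !=set0 ->
  exists phi, test_function Omega phi /\
    ~ {ae lebesgue_rV R n, forall x, Omega x -> phi x = 0}.
Proof.
move=> oO [x Ox].
have [r r0 rO] := nbhs_open_cube (open_nbhs_nbhs (conj oO Ox)).
have r20 : 0 < r / 2 by rewrite divr_gt0.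
pose a : 'rV[R]_n := \row_i (x ord0 i - r / 2).
pose b : 'rV[R]_n := \row_i (x ord0 i + r / 2).
have oE : open_cube x (r / 2) = box a b.
  by apply/seteqP; split=> y h i; have := h i; rewrite ?mxE ltr_distl.
have cO : closed_cube x (r / 2) `<=` Omega.
  move=> y h; apply: rO => i; apply: (le_lt_trans (h i)).
  by rewrite ltr_pdivrMr// mulr_natr mulr2n ltrDl.
have bc : box a b `<=` closed_cube x (r / 2) by rewrite -oE => y h i; exact: ltW.
exists (box_bump a b 0); split; first exact: test_box_bump bc cO.
move=> h; have := lebesgue_rV_open_cube_gt0 x r20.
rewrite oE lt_neqAle => /andP[/eqP + _]; apply.
apply/esym/(measure_negligible (measurable_box a b)).
apply: negligibleS h => y yb /= hy.
have := hy (cO _ (bc _ yb)); apply/eqP.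
rewrite lt0r_neq0// /box_bump; apply: prodr_gt0 => i _; have /andP[h1 h2] := yb i.
by apply: mulr_gt0; rewrite /flat pmulr_rgt0// subr_gt0 ?h1 ?h2 expr0 mul1r expR_gt0.
Qed.

End nontrivial.

(** * Comparison of the Nehari levels *)

Section limit.
Context {R : realType} {n : nat}.
Variable Omega : set 'rV[R]_n.
Hypothesis oO : open Omega.
Hypothesis bO : bounded_set Omega.
Hypothesis O0 : Omega !=set0.
Variable f : R -> R.
Hypothesis f_dual : dual_change f.
Hypothesis i0 : 'I_n.
Local Notation leb := (lebesgue_rV R n).
Local Notation test := (test_function Omega).
Local Notation E u := (grad_dot Omega u u).
Local Notation nl := (nonlin f).
Local Notation I := (energy Omega f).
Local Notation N := (nehari Omega f).
Local Notation m := (nehari_level Omega f).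
Local Notation ae0 v := {ae leb, forall x, Omega x -> v x = 0}.
Implicit Types (u w v phi : 'rV[R]_n -> R) (p q t : R).
Let mO := measurable_Omega oO.
Let vol : R := fine (leb Omega).

Let vol_ge0 : 0 <= vol. Proof. exact: fine_ge0. Qed.

Lemma Rint_cst (c : R) : \int[leb]_(x in Omega) c = c * vol.
Proof. exact: Rintegral_cst. Qed.

Lemma integrable_on_cst (c : R) : integrable_on Omega (fun=> c).
Proof. by apply: (integrable_on_bounded oO bO (C := `|c|)). Qed.

Lemma nehari_testE p t phi : test phi -> 0 < t -> ~ ae0 phi ->
  t ^+ 2 * E phi = \int[leb]_(x in Omega) nl p (t * phi x) ->
  N p (fun x => t * phi x).
Proof.
move=> tphi t0 nphi h; split.
- exact/test_H10/testZ.
- move=> h0; apply: nphi; apply: filterS h0 => x hx Ox.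
  by have := hx Ox; move/eqP; rewrite mulf_eq0 gt_eqF//= => /eqP.
- by rewrite denergyE grad_dot_testZ// h subrr.
Qed.

(** T is uniform in p >= p0, since |f|^p >= |f|^p0 - 1; this bounds the multiples
    of phi in N_p as p varies. *)
Lemma nehari_test_bound p0 phi : 4 < p0 -> test phi -> ~ ae0 phi ->
  exists2 T, 1 <= T & forall p t, p0 <= p -> T <= t ->
    t ^+ 2 * E phi < \int[leb]_(x in Omega) nl p (t * phi x).
Proof.
move=> p04 tphi nphi; have p00 : 0 < p0 by exact: lt_trans p04.
have mphi := test_measurable oO tphi.
have [T T1 hT] := superquadratic oO bO f_dual (2 * E phi + 1 + vol) p04 mphi nphi.
exists T => // p t pp0 Tt.
have p_gt0 : 0 < p by exact: lt_le_trans pp0.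
have p2 : 2 < p by apply: lt_le_trans pp0; apply: lt_trans p04; rewrite ltr_nat.
have tt := testZ t tphi.
have i1 := integrable_pow_test oO bO f_dual p00 tt.
have i2 := integrable_pow_test oO bO f_dual p_gt0 tt.
have i3 := integrable_nonlin_of_pow oO f_dual p2 (test_measurable oO tt) i2.
have h1 : (2 * E phi + 1 + vol) * t ^+ 2 <= \int[leb]_(x in Omega) (`|f (t * phi x)| `^ p0).
  rewrite -lee_fin /Rintegral fineK; first exact: hT.
  exact: integrable_fin_num.
have h2 : \int[leb]_(x in Omega) (`|f (t * phi x)| `^ p0) <=
    2 * \int[leb]_(x in Omega) (nl p (t * phi x)) + vol.
  rewrite -(RintZ oO)// -[vol]mul1r -Rint_cst -(RintD oO);
    [|exact: (integrable_onZ oO)|exact: integrable_on_cst].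
  apply: (Rint_le oO) => //; first by apply: (integrable_onD oO);
    [exact: (integrable_onZ oO)|exact: integrable_on_cst].
  move=> x _; set y := t * phi x.
  have /andP[hy _] := nonlin_bounds f_dual y p_gt0.
  rewrite ler_pdivrMr// mulrC in hy; apply: (@le_trans _ _ (`|f y| `^ p + 1));
    last by rewrite lerD2r.
  have [y1|/ltW y1] := leP 1 `|f y|.
    by apply: (@le_trans _ _ (`|f y| `^ p)); rewrite ?lerDl// ler_powR.
  apply: (@le_trans _ _ 1); last by rewrite lerDr powR_ge0.
  have -> : 1 = 1 `^ p0 :> R by rewrite powR1.
  by apply: ge0_ler_powR; rewrite ?nnegrE ?(ltW p00).
have t1 : 1 <= t ^+ 2 by rewrite exprn_ege1// (le_trans T1).
have h3 : vol <= vol * t ^+ 2 by rewrite ler_peMr.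
set A := \int[leb]_(x in Omega) (nl p _) in h2 *.
set B := \int[leb]_(x in Omega) _ in h1 h2.
have h4 : (2 * E phi + 1 + vol) * t ^+ 2 = 2 * (t ^+ 2 * E phi) + t ^+ 2 + vol * t ^+ 2 by
  move: (E phi) vol => a b; ring.
rewrite h4 in h1; set X := t ^+ 2 * E phi in h1 *.
have : 2 * X < 2 * A.
  have h5 := le_trans h1 h2.
  rewrite -(ltrD2r vol); apply: lt_le_trans h5.
  apply: lt_le_trans (_ : 2 * X + t ^+ 2 + vol <= _); last by rewrite lerD2l.
  by rewrite ltrD2r ltrDl (lt_le_trans _ t1).
by rewrite ltr_pM2l.
Qed.

(** The intermediate value theorem for t^2 ||phi||^2 - int nonlin(t phi): near t = 0
    the integral is O(t^4) because nonlin(s) <= |s|^p <= s^4 for |s| <= 1, and for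
    large t [nehari_test_bound] applies. *)
Lemma nehari_scaling p phi : 4 < p -> test phi -> ~ ae0 phi ->
  exists2 t, 0 < t & N p (fun x => t * phi x).
Proof.
move=> p4 tphi nphi; have p0 : 0 < p by exact: lt_trans p4.
have p2 : 2 < p by apply: lt_trans p4; rewrite ltr_nat.
have [C C0 [phiC _]] := test_bounds tphi.
have [T T1 hT] := nehari_test_bound p4 tphi nphi.
have {}hT := hT p T (lexx _) (lexx _).
have E0 := grad_dot_gt0 oO bO i0 (test_H10 oO bO tphi) nphi.
pose D t := t ^+ 2 * E phi - \int[leb]_(x in Omega) nl p (t * phi x).
have int_t t : integrable_on Omega (fun x => nl p (t * phi x)).
  have tt := testZ t tphi.
  have := integrable_nonlin_of_pow oO f_dual p2 (test_measurable oO tt) (integrable_pow_test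
    oO bO f_dual p0 tt).
  exact.
have nlub t x : 0 <= t -> nl p (t * phi x) <= (t * C) `^ p.
  move=> t0; have /andP[_ h] := nonlin_bounds f_dual (t * phi x) p0.
  apply: (le_trans h); apply: ge0_ler_powR; rewrite ?nnegrE ?(ltW p0) ?(mulr_ge0 t0 (ltW C0))//.
  by rewrite (le_trans (dual_norm_le f_dual _))// normrM (ger0_norm t0) ler_wpM2l.
have [s [s0 s1 Ds]] : exists s, [/\ 0 < s, s <= 1 & 0 <= D s].
  pose K := C ^+ 4 * vol + 1.
  have K0 : 0 < K by rewrite ltr_wpDl// mulr_ge0// exprn_ge0// ltW.
  (* The integral at s2 is at most s2^4 C^4 |Omega| <= s2^2 (s2^2 K). *)
  pose s2 := Num.min 1 (Num.min C^-1 (E phi / K)).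
  have s20 : 0 < s2 by rewrite !lt_min ltr01 invr_gt0 C0 divr_gt0.
  have s21 : s2 <= 1 by rewrite ge_min lexx.
  have s2C : s2 * C <= 1.
    by rewrite -ler_pdivlMr// div1r ge_min ge_min lexx orbT.
  have s2E : s2 ^+ 2 * K <= E phi.
    rewrite -ler_pdivlMr//; apply: (@le_trans _ _ s2).
      by rewrite expr2 ler_piMl// ltW.
    by rewrite !ge_min lexx !orbT.
  exists s2; split=> //; rewrite subr_ge0.
  apply: (@le_trans _ _ ((s2 * C) ^+ 4 * vol)).
    rewrite -Rint_cst; apply: (Rint_le oO) => //; first exact: integrable_on_cst.
    move=> x _; apply: (le_trans (nlub _ _ (ltW s20))).
    have sC0 : 0 < s2 * C by rewrite mulr_gt0.
    have h1 : 1 `^ (p - 4) = 1 :> R by rewrite powR1.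
    have -> : p = p - 4%:R + 4%:R by rewrite subrK.
    rewrite powR_natD ?(ltW sC0)// ?subrK ?lt0r_neq0//.
    rewrite ler_piMl ?exprn_ge0 ?(ltW sC0)// -[leRHS]h1.
    by apply: ge0_ler_powR; rewrite ?nnegrE ?subr_ge0 ?(ltW p4) ?(ltW sC0).
  have -> : (s2 * C) ^+ 4 * vol = s2 ^+ 2 * (s2 ^+ 2 * (C ^+ 4 * vol)) by ring.
  rewrite ler_wpM2l ?sqr_ge0// (le_trans _ s2E)// ler_wpM2l ?sqr_ge0//.
  by rewrite lerDl.
have cD : {within `[s, T], continuous D}.
  apply: continuous_in_subspaceT => t; rewrite inE/= in_itv/= => /andP[st tT].
  have cint : {in `]0, T + 1[%classic,
    continuous (fun t : R => \int[leb]_(x in Omega) nl p (t * phi x))}.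
    apply: (@continuity_under_integral _ _ _ leb (fun t x => nl p (t * phi x)) Omega
      mO 0 (T + 1) _ _ (fun=> ((T + 1) * C) `^ p)).
    - by move=> u _; exact: int_t.
    - apply: aeW => x _ u _.
      apply: (@continuous_comp R R R (fun u : R => u * phi x) (nl p));
        last exact: continuous_nonlin.
      by apply: cvgM; [exact: cvg_id|exact: cvg_cst].
    - exact: integrable_on_cst.
    - move=> u /=; rewrite in_itv/= => /andP[u0 uT]; apply: aeW => x _.
      rewrite ger0_norm ?nonlin_ge0// (le_trans (nlub _ _ (ltW u0)))//.
      apply: ge0_ler_powR; rewrite ?nnegrE ?(ltW p0) ?mulr_ge0 ?(ltW u0) ?(ltW C0)//.
        by rewrite addr_ge0// (le_trans _ T1).
      by rewrite ler_wpM2r ?(ltW C0)// ltW.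
  apply: cvgB; last first.
    apply: cint; rewrite inE/= in_itv/= (lt_le_trans s0 st)/=.
    by rewrite (le_lt_trans tT)// ltrDl.
  apply: cvgM; last exact: cvg_cst.
  by apply: exprn_continuous.
have sT : s <= T by exact: le_trans T1.
have DT : D T <= 0 by rewrite subr_le0 ltW.
have [|t] := @IVT R D s T 0 sT cD.
  by rewrite ge_min le_max DT orbT Ds.
rewrite in_itv/= => /andP[st _] /eqP; rewrite subr_eq0 => /eqP Dt.
have t0 : 0 < t by exact: lt_le_trans st.
by exists t => //; exact: nehari_testE.
Qed.

Lemma energy_nehari_has_inf p : 4 < p -> has_inf (I p @` N p).
Proof.
move=> p4; split.
  have [phi [tphi nphi]] := test_nonzero oO O0.
  have [t t0 Nt] := nehari_scaling p4 tphi nphi.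
  by exists (I p (fun x => t * phi x)), (fun x => t * phi x).
by exists 0 => _ [v Nv <-]; exact: (energy_nehari_ge0 oO bO f_dual i0 p4 Nv).
Qed.

Lemma nehari_level_le p v : 4 < p -> N p v -> m p <= I p v.
Proof.
move=> p4 Nv; have [_ hl] := energy_nehari_has_inf p4.
by apply: (ge_inf hl); exists v.
Qed.

(** Compare I_q and I_p at a multiple in N_q of a test function for which I_p is
    nowhere much larger on its ray than at a given point of N_p. *)
Lemma nehari_level_lower p q : 4 < p -> p < q -> m q <= m p + (p^-1 - q^-1) * vol.
Proof.
move=> p4 pq; have q4 := lt_trans p4 pq; have p0 : 0 < p by exact: lt_trans p4.
have q0 := lt_trans p0 pq.
rewrite -lerBlDr; apply: lb_le_inf; first by case: (energy_nehari_has_inf p4).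
move=> _ [v Nv <-]; rewrite lerBlDr; apply/ler_addgt0Pr => e e0.
have [phi [tphi nphi phile]] := test_approx oO bO f_dual i0 p4 Nv e0.
have [t t0 Nt] := nehari_scaling q4 tphi nphi.
apply: (le_trans (nehari_level_le q4 Nt)).
rewrite addrAC; apply: (@le_trans _ _ (I p (fun x => t * phi x) + (p^-1 - q^-1) * vol));
  last first.
  by rewrite lerD2r phile.
rewrite !energy_testE// -addrA lerD2l.
have tt := testZ t tphi.
have ip := integrable_pow_test oO bO f_dual p0 tt;
  have iq := integrable_pow_test oO bO f_dual q0 tt.
rewrite -Rint_cst -lerBlDl opprK addrC -!(RintZ oO)// -RintegralB//;
  [|exact: (integrable_onZ oO)|exact: (integrable_onZ oO)].
apply: (Rint_le oO); [|exact: integrable_on_cst|].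
  by apply: (integrable_onB oO); exact: (integrable_onZ oO).
move=> x _; rewrite ![_^-1 * _ `^ _]mulrC; exact: powR_div_le.
Qed.

(** A single test function, nearly optimal at q, is used for all p close to q. *)
Lemma nehari_level_upper q (e : R) : 4 < q -> 0 < e ->
  exists2 p0, 4 < p0 < q & \forall p \near q, p0 <= p -> p < q -> m p <= m q + e.
Proof.
move=> q4 e0; pose p0 := (4 + q) / 2.
have p04 : 4 < p0 by rewrite ltr_pdivlMr// mulr_natr mulr2n ltrD2l.
have p0q : p0 < q by rewrite ltr_pdivrMr// mulr_natr mulr2n ltrD2r.
have q0 : 0 < q by exact: lt_trans q4.
exists p0; first by rewrite p04.
have e3 : 0 < e / 3 by rewrite divr_gt0.
have [_ [v Nv <-] ve] := inf_adherent e3 (energy_nehari_has_inf q4).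
have [phi [tphi nphi phile]] := test_approx oO bO f_dual i0 q4 Nv e3.
have [C C0 [phiC _]] := test_bounds tphi.
have [T T1 hT] := nehari_test_bound p04 tphi nphi.
(* M bounds |f(t phi)| for all the multiples t phi in N_p with p >= p0, as |f(s)| <= |s|. *)
pose M := Num.max 1 (T * C); have M1 : 1 <= M by rewrite le_max lexx.
have M0 : 0 < M by exact: lt_le_trans M1.
have nearp : \forall p \near q, vol * (M `^ q / q * (1 - M `^ (p - q))) < e / 3.
  have h : (vol * (M `^ q / q * (1 - M `^ (p - q)))) @[p --> q] --> (0 : R).
    have -> : 0 = vol * (M `^ q / q * (1 - expR ((q - q) * ln M))).
      by rewrite subrr mul0r expR0 subrr !mulr0.
    rewrite (_ : (fun p => _) = (fun p => vol * (M `^ q / q * (1 - expR ((p - q) * ln M)))));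
      last first.
      by apply/funext => p; rewrite /powR gt_eqF.
    apply: cvgM; first exact: cvg_cst.
    apply: cvgM; first exact: cvg_cst.
    apply: cvgB; first exact: cvg_cst.
    apply: continuous_cvg; first exact: continuous_expR.
    apply: cvgM; last exact: cvg_cst.
    by apply: cvgB; [exact: cvg_id|exact: cvg_cst].
  have /cvgrPdist_lt/(_ _ e3) := h.
  by apply: filterS => p; rewrite sub0r normrN; apply: le_lt_trans; exact: ler_norm.
near=> p => p0p pq; have p4 : 4 < p by exact: lt_le_trans p0p.
have p_gt0 : 0 < p by exact: lt_trans p4.
have np : vol * (M `^ q / q * (1 - M `^ (p - q))) < e / 3 by near: p.
have [t t0 Nt] := nehari_scaling p4 tphi nphi.
have tT : t <= T.
  rewrite leNgt; apply/negP => /ltW Tt; have := hT p t p0p Tt.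
  by have [_ _] := Nt; rewrite denergyE grad_dot_testZ// => /eqP;
    rewrite subr_eq0 => /eqP ->; rewrite ltxx.
have tt := testZ t tphi.
have ip := integrable_pow_test oO bO f_dual p_gt0 tt;
  have iq := integrable_pow_test oO bO f_dual q0 tt.
apply: (le_trans (nehari_level_le p4 Nt)).
apply: (@le_trans _ _ (I q (fun x => t * phi x) + vol * (M `^ q / q * (1 - M `^ (p - q))))).
  rewrite !energy_testE// -addrA lerD2l [vol * _]mulrC -Rint_cst -lerBlDl opprK addrC.
  rewrite -!(RintZ oO)// -RintegralB//;
    [|exact: (integrable_onZ oO)|exact: (integrable_onZ oO)].
  apply: (Rint_le oO); [|exact: integrable_on_cst|].
    by apply: (integrable_onB oO); exact: (integrable_onZ oO).
  move=> x _; rewrite ![_^-1 * _ `^ _]mulrC; apply: powR_div_le_bounded => //.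
  rewrite normr_ge0/= (le_trans (dual_norm_le f_dual _))// normrM (gtr0_norm t0).
  by rewrite le_max; apply/orP; right; apply: ler_pM => //; exact: ltW.
have -> : m q + e = m q + e / 3 + e / 3 + e / 3 by move: (m q) => a; field.
by rewrite lerD// ?(ltW np)// (le_trans (phile t t0))// lerD2r ltW.
Unshelve. all: by end_near. Qed.

End limit.

Theorem theorem3 (R : realType) (N : nat) (Omega : set 'rV[R]_N) (f : R -> R)
    (N_ge3 : (3 <= N)%N) (Omega_dom : smooth_bounded_domain Omega)
    (f_dual : dual_change f) :
  nehari_level Omega f p
    @[p --> within [set` `]4, 2 * critical_exponent R N[]
              (nbhs (2 * critical_exponent R N))]
  --> nehari_level Omega f (2 * critical_exponent R N).
Proof.
have [nonempty_O oO _ bO _] := Omega_dom.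
have i0 : 'I_N := Ordinal (ltn_trans (ltn0Sn 1) N_ge3).
set q := 2 * critical_exponent R N.
have q4 : 4 < q.
  have N2 : 0 < N%:R - 2 :> R by rewrite subr_gt0 ltr_nat.
  rewrite /q /critical_exponent mulrA ltr_pdivlMr//; lra.
have q0 : 0 < q by exact: lt_trans q4.
apply/cvgrPdist_le => e e0; rewrite near_withinE.
have [p0 /andP[p04 p0q] up] := nehari_level_upper oO bO nonempty_O f_dual i0 q4 e0.
have low : \forall p \near q, (p^-1 - q^-1) * fine (lebesgue_rV R N Omega) < e.
  have h : ((p^-1 - q^-1) * fine (lebesgue_rV R N Omega)) @[p --> q] --> (0 : R).
    have -> : 0 = (q^-1 - q^-1) * fine (lebesgue_rV R N Omega) by rewrite subrr mul0r.
    apply: cvgM; last exact: cvg_cst.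
    apply: cvgB; last exact: cvg_cst.
    by apply: cvgV; [exact: lt0r_neq0|exact: cvg_id].
  have /cvgrPdist_lt/(_ _ e0) := h.
  by apply: filterS => p; rewrite sub0r normrN; apply: le_lt_trans; exact: ler_norm.
near=> p; rewrite /= in_itv/= => /andP[p4 pq].
have pp0 : p0 <= p by apply: ltW; near: p; exact: lt_nbhsr.
rewrite ler_distl; apply/andP; split.
  have : p0 <= p -> p < q -> nehari_level Omega f p <= nehari_level Omega f q + e by near: p.
  by move=> /(_ pp0 pq); rewrite lerBlDr.
apply: (le_trans (nehari_level_lower oO bO nonempty_O f_dual i0 p4 pq)).
rewrite lerD2l; apply: ltW; by near: p.
Unshelve. all: by end_near. Qed.
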